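(* Let $k$ be a field, $\mathfrak S$ a $k$-linear Grothendieck category and $C$ a $k$-coalgebra. Then the category $\mathfrak S^C$ of right $C$-comodule objects in $\mathfrak S$ is a Grothendieck category.
   Context: Write $\otimes=\otimes_k$. For $\mathcal M\in\mathfrak S$ and a $k$-vector space $V$, $\mathcal M\otimes V\in\mathfrak S$ is defined by letting $\mathcal M\otimes-:k\text{-Mod}\to\mathfrak S$ be the left adjoint of $\mathfrak S(\mathcal M,-):\mathfrak S\to k\text{-Mod}$ (so $\mathcal M\otimes V$ is a direct sum of $\dim V$ copies of $\mathcal M$). A right $C$-comodule object in $\mathfrak S$ is an object $\mathcal P\in\mathfrak S$ with a morphism $\Delta_{\mathcal P}:\mathcal P\to\mathcal P\otimes C$ such that $(\mathcal P\otimes\epsilon)\circ\Delta_{\mathcal P}=\mathrm{id}$ (with $\epsilon$ the counit of $C$) and $(\mathcal P\otimes\Delta_C)\circ\Delta_{\mathcal P}=(\Delta_{\mathcal P}\otimes C)\circ\Delta_{\mathcal P}$. Morphisms $\phi:\mathcal P\to\mathcal P'$ in $\mathfrak S^C$ are morphisms in $\mathfrak S$ with $\Delta_{\mathcal P'}\circ\phi=(\phi\otimes C)\circ\Delta_{\mathcal P}$. *)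

(* Defs.v *)
From HB Require Import structures.
From mathcomp Require Import all_boot all_algebra.
From mathcomp Require Import boolp functions.

Set Implicit Arguments.
Unset Strict Implicit.
Unset Printing Implicit Defensive.

Import GRing.Theory.
Local Open Scope ring_scope.
Local Open Scope quotient_scope.

(* U (x) V is the set of finite formal sums of pairs (u, v), two of them being
   identified when every bilinear map takes the same value on both. The scalars
   are absorbed in the first factor. The universal property is
   tensor_liftE / tensor_lift_uniq below. *)

Section TensorProduct.
Variables (k : fieldType) (U V : lmodType k).

Definition formal_eval (W : lmodType k) (b : U -> V -> W) (s : seq (U * V)) : W :=
  \sum_(p <- s) b p.1 p.2.

Definition formal_eq (s t : seq (U * V)) : bool :=
  `[< forall (W : lmodType k) (b : {bilinear U -> V -> W}),
        formal_eval b s = formal_eval b t >].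

Lemma formal_eqP s t :
  reflect (forall (W : lmodType k) (b : {bilinear U -> V -> W}),
             formal_eval b s = formal_eval b t) (formal_eq s t).
Proof. exact: asboolP. Qed.

Lemma formal_eq_refl : reflexive formal_eq.
Proof. by move=> s; apply/formal_eqP. Qed.

Lemma formal_eq_sym : symmetric formal_eq.
Proof.
by move=> s t; apply/formal_eqP/formal_eqP => e W b; rewrite e.
Qed.

Lemma formal_eq_trans : transitive formal_eq.
Proof.
move=> t s r /formal_eqP e1 /formal_eqP e2.
by apply/formal_eqP => W b; rewrite e1.
Qed.

Canonical formal_equiv :=
  EquivRel formal_eq formal_eq_refl formal_eq_sym formal_eq_trans.

Definition tensor : Type := {eq_quot formal_eq}.
HB.instance Definition _ := Choice.on tensor.
HB.instance Definition _ := EqQuotient.on tensor.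

Definition tensor_of_sum (s : seq (U * V)) : tensor := \pi_tensor s.

Definition tensor_lift (W : lmodType k) (b : U -> V -> W) (t : tensor) : W :=
  formal_eval b (repr t).

Lemma tensor_lift_of_sum (W : lmodType k) (b : {bilinear U -> V -> W}) s :
  tensor_lift b (tensor_of_sum s) = formal_eval b s.
Proof.
rewrite /tensor_lift /tensor_of_sum.
have /eqmodP/formal_eqP -> // : repr (\pi_tensor s) = s %[mod tensor].
by rewrite reprK.
Qed.

Lemma tensor_eqP (x y : tensor) :
  (forall (W : lmodType k) (b : {bilinear U -> V -> W}),
     tensor_lift b x = tensor_lift b y) -> x = y.
Proof.
by move=> h; rewrite -[x]reprK -[y]reprK; apply/eqmodP/formal_eqP.
Qed.

Definition tensor_add (x y : tensor) : tensor := tensor_of_sum (repr x ++ repr y).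
Definition tensor_scale (a : k) (x : tensor) : tensor :=
  tensor_of_sum [seq (a *: p.1, p.2) | p <- repr x].
Definition tensor_zero : tensor := tensor_of_sum [::].
Definition tensor_opp (x : tensor) : tensor := tensor_scale (-1) x.

Section Eval.
Variables (W : lmodType k) (b : {bilinear U -> V -> W}).

Lemma tensor_lift_add x y :
  tensor_lift b (tensor_add x y) = tensor_lift b x + tensor_lift b y.
Proof. by rewrite tensor_lift_of_sum /formal_eval big_cat. Qed.

Lemma tensor_lift_scale a x :
  tensor_lift b (tensor_scale a x) = a *: tensor_lift b x.
Proof.
rewrite tensor_lift_of_sum /formal_eval big_map scaler_sumr.
by apply: eq_bigr => p _ /=; rewrite linearZl_LR.
Qed.

Lemma tensor_lift_zero : tensor_lift b tensor_zero = 0.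
Proof. by rewrite tensor_lift_of_sum /formal_eval big_nil. Qed.

End Eval.

Let liftE := (tensor_lift_add, tensor_lift_scale, tensor_lift_zero).

Lemma tensor_addA : associative tensor_add.
Proof. by move=> x y z; apply: tensor_eqP => W b; rewrite !liftE addrA. Qed.
Lemma tensor_addC : commutative tensor_add.
Proof. by move=> x y; apply: tensor_eqP => W b; rewrite !liftE addrC. Qed.
Lemma tensor_add0 : left_id tensor_zero tensor_add.
Proof. by move=> x; apply: tensor_eqP => W b; rewrite !liftE add0r. Qed.
Lemma tensor_addN : left_inverse tensor_zero tensor_opp tensor_add.
Proof.
by move=> x; apply: tensor_eqP => W b; rewrite !liftE scaleN1r addNr.
Qed.

HB.instance Definition _ :=
  GRing.isZmodule.Build tensor tensor_addA tensor_addC tensor_add0 tensor_addN.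

Lemma tensor_scaleA a c x : tensor_scale a (tensor_scale c x) = tensor_scale (a * c) x.
Proof. by apply: tensor_eqP => W b; rewrite !liftE scalerA. Qed.
Lemma tensor_scale1 : left_id 1 tensor_scale.
Proof. by move=> x; apply: tensor_eqP => W b; rewrite !liftE scale1r. Qed.
Lemma tensor_scaleDr : right_distributive tensor_scale +%R.
Proof. by move=> a x y; apply: tensor_eqP => W b; rewrite !liftE scalerDr. Qed.
Lemma tensor_scaleDl x : {morph tensor_scale^~ x : a c / a + c}.
Proof. by move=> a c; apply: tensor_eqP => W b; rewrite !liftE scalerDl. Qed.

HB.instance Definition _ := GRing.Zmodule_isLmodule.Build k tensor
  tensor_scaleA tensor_scale1 tensor_scaleDr tensor_scaleDl.

Lemma tensor_lift_linear (W : lmodType k) (b : {bilinear U -> V -> W}) :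
  linear (tensor_lift b).
Proof. by move=> a x y; rewrite tensor_lift_add tensor_lift_scale. Qed.

HB.instance Definition _ (W : lmodType k) (b : {bilinear U -> V -> W}) :=
  GRing.isLinear.Build k tensor W _ (tensor_lift b) (tensor_lift_linear b).

Definition pure (u : U) (v : V) : tensor := tensor_of_sum [:: (u, v)].

Lemma tensor_liftE (W : lmodType k) (b : {bilinear U -> V -> W}) u v :
  tensor_lift b (pure u v) = b u v.
Proof. by rewrite tensor_lift_of_sum /formal_eval big_seq1. Qed.

Lemma pure_bilinear : bilinear_for *:%R *:%R pure.
Proof.
split=> [v a u u'|u a v v']; apply: tensor_eqP => W b;
  by rewrite tensor_lift_linear !tensor_liftE ?linearPl ?linearPr.
Qed.

HB.instance Definition _ := bilinear_isBilinear.Build k U V tensor _ _ pure pure_bilinear.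

Lemma tensor_sum_pure (t : tensor) : t = \sum_(p <- repr t) pure p.1 p.2.
Proof.
apply: tensor_eqP => W b; rewrite linear_sum.
by apply: eq_bigr => p _; rewrite /= tensor_liftE.
Qed.

Lemma tensor_lift_uniq (W : lmodType k) (f g : {linear tensor -> W}) :
  (forall u v, f (pure u v) = g (pure u v)) -> f =1 g.
Proof.
move=> e t; rewrite [t]tensor_sum_pure !linear_sum.
by apply: eq_bigr => p _; rewrite e.
Qed.

End TensorProduct.

Section TensorMap.
Variables (k : fieldType) (U U' V V' : lmodType k).
Variables (f : {linear U -> U'}) (g : {linear V -> V'}).

Definition pure_map (u : U) (v : V) : tensor U' V' := pure (f u) (g v).

Lemma pure_map_bilinear : bilinear_for *:%R *:%R pure_map.
Proof.
by split=> [v a u u'|u a v v']; rewrite /pure_map linearP ?linearPl ?linearPr.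
Qed.

HB.instance Definition _ :=
  bilinear_isBilinear.Build k U V (tensor U' V') _ _ pure_map pure_map_bilinear.

Definition tensor_map : {linear tensor U V -> tensor U' V'} := tensor_lift pure_map.

Lemma tensor_mapE u v : tensor_map (pure u v) = pure (f u) (g v).
Proof. exact: tensor_liftE. Qed.

End TensorMap.

Section TensorAssoc.
Variables (k : fieldType) (U V W : lmodType k).

Definition pure_assoc (w : W) (u : U) (v : V) : tensor U (tensor V W) :=
  pure u (pure v w).

Lemma pure_assoc_bilinear w : bilinear_for *:%R *:%R (pure_assoc w).
Proof.
by split=> [v a u u'|u a v v']; rewrite /pure_assoc ?linearPl ?linearPr.
Qed.

HB.instance Definition _ w :=
  bilinear_isBilinear.Build k U V (tensor U (tensor V W)) _ _
    (pure_assoc w) (pure_assoc_bilinear w).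

Definition tensor_assoc_pure (t : tensor U V) (w : W) : tensor U (tensor V W) :=
  tensor_lift (pure_assoc w) t.

Lemma tensor_assoc_pure_bilinear : bilinear_for *:%R *:%R tensor_assoc_pure.
Proof.
split=> [w a t t'|t a w w']; first exact: tensor_lift_linear.
rewrite /tensor_assoc_pure /tensor_lift /formal_eval /= scaler_sumr -big_split.
by apply: eq_bigr => p _; rewrite /= /pure_assoc !linearPr.
Qed.

HB.instance Definition _ :=
  bilinear_isBilinear.Build k (tensor U V) W (tensor U (tensor V W)) _ _
    tensor_assoc_pure tensor_assoc_pure_bilinear.

Definition tensor_assoc : {linear tensor (tensor U V) W -> tensor U (tensor V W)} :=
  tensor_lift tensor_assoc_pure.

Lemma tensor_assocE u v w : tensor_assoc (pure (pure u v) w) = pure u (pure v w).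
Proof. by apply: etrans (tensor_liftE _ _ _) _; exact: tensor_liftE. Qed.

End TensorAssoc.
Arguments tensor_assoc {k U V W}.

Section TensorUnit.
Variables (k : fieldType) (V : lmodType k).

Definition scale_left (a : k^o) (v : V) : V := a *: v.
Definition scale_right (v : V) (a : k^o) : V := a *: v.

Lemma scale_left_bilinear : bilinear_for *:%R *:%R scale_left.
Proof.
split=> [v a c d|c a v w]; rewrite /scale_left /=.
  by rewrite scalerDl scalerA.
by rewrite scalerDr !scalerA mulrC.
Qed.

Lemma scale_right_bilinear : bilinear_for *:%R *:%R scale_right.
Proof.
split=> [c a v w|v a c d]; rewrite /scale_right /=.
  by rewrite scalerDr !scalerA mulrC.
by rewrite scalerDl scalerA.
Qed.

HB.instance Definition _ :=
  bilinear_isBilinear.Build k k^o V V _ _ scale_left scale_left_bilinear.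
HB.instance Definition _ :=
  bilinear_isBilinear.Build k V k^o V _ _ scale_right scale_right_bilinear.

Definition tensor_unitl : {linear tensor k^o V -> V} := tensor_lift scale_left.
Definition tensor_unitr : {linear tensor V k^o -> V} := tensor_lift scale_right.

End TensorUnit.
Arguments tensor_unitl {k V}.
Arguments tensor_unitr {k V}.

Record coalgebra (k : fieldType) := Coalgebra {
  coalgebra_carrier :> lmodType k;
  comul : {linear coalgebra_carrier -> tensor coalgebra_carrier coalgebra_carrier};
  counit : {linear coalgebra_carrier -> k^o};
  comulA : forall c,
    tensor_assoc (tensor_map comul idfun (comul c))
      = tensor_map idfun comul (comul c);
  counit_comul : forall c, tensor_unitl (tensor_map counit idfun (comul c)) = c;
  comul_counit : forall c, tensor_unitr (tensor_map idfun counit (comul c)) = c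
}.
Arguments comul {k} c : rename.
Arguments counit {k} c : rename.

Record linear_category (k : fieldType) := LinearCategory {
  obj :> Type;
  hom : obj -> obj -> lmodType k;
  idm : forall X, hom X X;
  compm : forall X Y Z, hom Y Z -> hom X Y -> hom X Z;
  compmA : forall X Y Z T (h : hom Z T) (g : hom Y Z) (f : hom X Y),
    compm h (compm g f) = compm (compm h g) f;
  comp1m : forall X Y (f : hom X Y), compm (idm Y) f = f;
  compm1 : forall X Y (f : hom X Y), compm f (idm X) = f;
  compm_bilinear : forall X Y Z, bilinear_for *:%R *:%R (@compm X Y Z)
}.
Arguments hom {k} S X Y : rename.
Arguments idm {k} S X : rename.
Arguments compm {k S X Y Z} g f : rename.

Declare Scope linear_category_scope.
Delimit Scope linear_category_scope with LC.
Local Open Scope linear_category_scope.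
Notation "g ∘ f" := (compm g f)
  (at level 40, left associativity) : linear_category_scope.

HB.instance Definition _ (k : fieldType) (S : linear_category k) (X Y Z : S) :=
  bilinear_isBilinear.Build k (hom S Y Z) (hom S X Y) (hom S X Z) _ _
    (@compm k S X Y Z) (compm_bilinear X Y Z).

Section CompositionLinear.
Variables (k : fieldType) (S : linear_category k) (X Y Z : S).
Implicit Types (g : hom S Y Z) (f : hom S X Y) (a : k).

Lemma compmPl a g g' f : (a *: g + g') ∘ f = a *: (g ∘ f) + g' ∘ f.
Proof. exact: linearPl. Qed.
Lemma compmPr a g f f' : g ∘ (a *: f + f') = a *: (g ∘ f) + g ∘ f'.
Proof. exact: linearPr. Qed.
Lemma comp0m f : (0 : hom S Y Z) ∘ f = 0.
Proof. exact: linear0l. Qed.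
Lemma compm0 g : g ∘ (0 : hom S X Y) = 0.
Proof. exact: linear0r. Qed.
Lemma compmBl g g' f : (g - g') ∘ f = g ∘ f - g' ∘ f.
Proof. exact: linearBl. Qed.
Lemma compmBr g f f' : g ∘ (f - f') = g ∘ f - g ∘ f'.
Proof. exact: linearBr. Qed.

End CompositionLinear.

Section Abelian.
Variables (k : fieldType) (S : linear_category k).

Definition is_mono (X Y : S) (f : hom S X Y) : Prop :=
  forall (T : S) (g h : hom S T X), f ∘ g = f ∘ h -> g = h.

Definition is_epi (X Y : S) (f : hom S X Y) : Prop :=
  forall (T : S) (g h : hom S Y T), g ∘ f = h ∘ f -> g = h.

Definition is_kernel (K X Y : S) (f : hom S X Y) (i : hom S K X) : Prop :=
  f ∘ i = 0 /\
  forall (T : S) (g : hom S T X), f ∘ g = 0 -> exists! h : hom S T K, i ∘ h = g.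

Definition is_cokernel (X Y Q : S) (f : hom S X Y) (p : hom S Y Q) : Prop :=
  p ∘ f = 0 /\
  forall (T : S) (g : hom S Y T), g ∘ f = 0 -> exists! h : hom S Q T, h ∘ p = g.

Definition is_zero_object (Z : S) : Prop :=
  (forall (X : S) (f : hom S X Z), f = 0) /\
  (forall (X : S) (f : hom S Z X), f = 0).

Definition is_biproduct (X Y B : S) (i1 : hom S X B) (i2 : hom S Y B)
    (p1 : hom S B X) (p2 : hom S B Y) : Prop :=
  [/\ p1 ∘ i1 = idm S X, p2 ∘ i2 = idm S Y, p1 ∘ i2 = 0, p2 ∘ i1 = 0
    & i1 ∘ p1 + i2 ∘ p2 = idm S B].

Record abelian : Prop := Abelian {
  abelian_zero : exists Z : S, is_zero_object Z;
  abelian_biproduct : forall X Y : S, exists (B : S) i1 i2 p1 p2,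
    @is_biproduct X Y B i1 i2 p1 p2;
  abelian_kernel : forall (X Y : S) (f : hom S X Y),
    exists (K : S) (i : hom S K X), is_kernel f i;
  abelian_cokernel : forall (X Y : S) (f : hom S X Y),
    exists (Q : S) (p : hom S Y Q), is_cokernel f p;
  abelian_mono : forall (X Y : S) (f : hom S X Y), is_mono f ->
    exists (Z : S) (g : hom S Y Z), is_kernel g f;
  abelian_epi : forall (X Y : S) (f : hom S X Y), is_epi f ->
    exists (Z : S) (g : hom S Z X), is_cokernel g f
}.

Definition short_exact (X Y Z : S) (f : hom S X Y) (g : hom S Y Z) : Prop :=
  is_kernel g f /\ is_cokernel f g.

Definition is_generator (G : S) : Prop :=
  forall (X Y : S) (f g : hom S X Y),
    (forall h : hom S G X, f ∘ h = g ∘ h) -> f = g.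

End Abelian.

(* Index categories live in their own universe: the objects of a
   linear_category form a large type, hence linear_category cannot be reused
   for them. "Small" means of the size of a vector space: tensoring_exists uses
   a vector space as index set, and object_functions / arrow_functions force
   index categories not to exceed the size of the carriers of lmodType k. *)
Record small_category := SmallCategory {
  sobj :> Type;
  shom : sobj -> sobj -> Type;
  sid : forall i, shom i i;
  scomp : forall i j l, shom j l -> shom i j -> shom i l;
  scompA : forall i j l m (w : shom l m) (v : shom j l) (u : shom i j),
    scomp w (scomp v u) = scomp (scomp w v) u;
  scomp1m : forall i j (u : shom i j), scomp (sid j) u = u;
  scompm1 : forall i j (u : shom i j), scomp u (sid i) = u
}.
Arguments shom J i j : clear implicits, rename.
Arguments sid J i : clear implicits, rename.
Arguments scomp {J i j l} v u : rename.

Definition object_functions (k : fieldType) (J : small_category) : lmodType k :=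
  (J -> k^o : Type).
Definition arrow_functions (k : fieldType) (J : small_category) (i j : J) :
  lmodType k := (shom J i j -> k^o : Type).

Record filtered (J : small_category) : Prop := Filtered {
  filtered_inhabited : inhabited J;
  filtered_object : forall i j : J, exists l : J,
    inhabited (shom J i l) /\ inhabited (shom J j l);
  filtered_arrow : forall (i j : J) (u v : shom J i j),
    exists (l : J) (w : shom J j l), scomp w u = scomp w v
}.

Section Colimits.
Variables (k : fieldType) (S : linear_category k).

Record diagram (J : small_category) := Diagram {
  dobj :> J -> S;
  dmap : forall i j, shom J i j -> hom S (dobj i) (dobj j);
  dmap_id : forall i, dmap (sid J i) = idm S (dobj i);
  dmap_comp : forall i j l (v : shom J j l) (u : shom J i j),
    dmap (scomp v u) = dmap v ∘ dmap u
}.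
Arguments dmap {J} F {i j} u : rename.

Definition is_natural (J : small_category) (F G : diagram J)
    (a : forall j, hom S (F j) (G j)) : Prop :=
  forall i j (u : shom J i j), a j ∘ dmap F u = dmap G u ∘ a i.

Definition is_cocone (J : small_category) (F : diagram J) (X : S)
    (c : forall j, hom S (F j) X) : Prop :=
  forall i j (u : shom J i j), c j ∘ dmap F u = c i.

Definition is_colimit (J : small_category) (F : diagram J) (X : S)
    (c : forall j, hom S (F j) X) : Prop :=
  is_cocone c /\
  forall (Y : S) (d : forall j, hom S (F j) Y), is_cocone d ->
    exists! h : hom S X Y, forall j, h ∘ c j = d j.

Definition cocomplete : Prop :=
  forall (J : small_category) (F : diagram J),
    exists (X : S) (c : forall j, hom S (F j) X), is_colimit c.

Definition exact_filtered_colimits : Prop :=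
  forall (J : small_category), filtered J ->
  forall (F G H : diagram J)
    (a : forall j, hom S (F j) (G j)) (b : forall j, hom S (G j) (H j)),
    is_natural a -> is_natural b -> (forall j, short_exact (a j) (b j)) ->
  forall (X Y Z : S) (c : forall j, hom S (F j) X) (d : forall j, hom S (G j) Y)
    (e : forall j, hom S (H j) Z),
    is_colimit c -> is_colimit d -> is_colimit e ->
  forall (f : hom S X Y) (g : hom S Y Z),
    (forall j, f ∘ c j = d j ∘ a j) -> (forall j, g ∘ d j = e j ∘ b j) ->
    short_exact f g.

Record grothendieck : Prop := Grothendieck {
  grothendieck_abelian : abelian S;
  grothendieck_cocomplete : cocomplete;
  grothendieck_exact : exact_filtered_colimits;
  grothendieck_generator : exists G : S, is_generator G
}.

End Colimits.

(* A choice, for every M, of a left adjoint M (x) - of S(M, -) : S -> k-Mod,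
   given by its unit V -> S(M, M (x) V), a universal arrow. *)
Record tensoring (k : fieldType) (S : linear_category k) := Tensoring {
  tobj : S -> lmodType k -> S;
  tunit : forall (M : S) (V : lmodType k), {linear V -> hom S M (tobj M V)};
  tlift : forall (M : S) (V : lmodType k) (N : S),
    {linear V -> hom S M N} -> hom S (tobj M V) N;
  tliftE : forall M (V : lmodType k) N (f : {linear V -> hom S M N}) (v : V),
    tlift f ∘ tunit M V v = f v;
  tlift_uniq : forall M (V : lmodType k) N (f : {linear V -> hom S M N}) (h : hom S (tobj M V) N),
    (forall v, h ∘ tunit M V v = f v) -> h = tlift f
}.
Arguments tobj {k S} T M V : rename.
Arguments tunit {k S} T M V : rename.
Arguments tlift {k S} T {M V N} f : rename.

Section TensoringMaps.
Variables (k : fieldType) (S : linear_category k) (T : tensoring S).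

Definition tmapr_fun (M : S) (V W : lmodType k) (f : {linear V -> W}) (v : V) :
  hom S M (tobj T M W) := tunit T M W (f v).

Lemma tmapr_fun_linear M V W f : linear (@tmapr_fun M V W f).
Proof. by move=> a v w; rewrite /tmapr_fun !linearP. Qed.

HB.instance Definition _ M V W f :=
  GRing.isLinear.Build k V _ _ (@tmapr_fun M V W f) (@tmapr_fun_linear M V W f).

(* M (x) f *)
Definition tmapr (M : S) (V W : lmodType k) (f : {linear V -> W}) :
  hom S (tobj T M V) (tobj T M W) := tlift T (@tmapr_fun M V W f).

Definition tmapl_fun (M N : S) (V : lmodType k) (phi : hom S M N) (v : V) :
  hom S M (tobj T N V) := tunit T N V v ∘ phi.

Lemma tmapl_fun_linear M N V phi : linear (@tmapl_fun M N V phi).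
Proof. by move=> a v w; rewrite /tmapl_fun linearP compmPl. Qed.

HB.instance Definition _ M N V phi :=
  GRing.isLinear.Build k V _ _ (@tmapl_fun M N V phi) (@tmapl_fun_linear M N V phi).

(* phi (x) V *)
Definition tmapl (M N : S) (V : lmodType k) (phi : hom S M N) :
  hom S (tobj T M V) (tobj T N V) := tlift T (@tmapl_fun M N V phi).

Definition tunitor_fun (M : S) (a : k^o) : hom S M M := a *: idm S M.

Lemma tunitor_fun_linear M : linear (@tunitor_fun M).
Proof. by move=> a v w; rewrite /tunitor_fun scalerDl scalerA. Qed.

HB.instance Definition _ M :=
  GRing.isLinear.Build k k^o _ _ (@tunitor_fun M) (@tunitor_fun_linear M).

(* The canonical isomorphism M (x) k -> M. *)
Definition tunitor (M : S) : hom S (tobj T M k^o) M := tlift T (@tunitor_fun M).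

Section Assoc.
Variables (M : S) (U V : lmodType k).

Definition tassoc_pure (u : U) (v : V) : hom S M (tobj T (tobj T M U) V) :=
  tunit T (tobj T M U) V v ∘ tunit T M U u.

Lemma tassoc_pure_bilinear : bilinear_for *:%R *:%R tassoc_pure.
Proof.
by split=> [v a u u'|u a v v']; rewrite /tassoc_pure linearP ?compmPl ?compmPr.
Qed.

HB.instance Definition _ :=
  bilinear_isBilinear.Build k U V _ _ _ tassoc_pure tassoc_pure_bilinear.

(* The canonical isomorphism M (x) (U (x) V) -> (M (x) U) (x) V. *)
Definition tassoc : hom S (tobj T M (tensor U V)) (tobj T (tobj T M U) V) :=
  tlift T (tensor_lift tassoc_pure).

End Assoc.

End TensoringMaps.

Section Comodules.
Variables (k : fieldType) (S : linear_category k) (T : tensoring S).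
Variable C : coalgebra k.

Record comodule := Comodule {
  comodule_obj :> S;
  coact : hom S comodule_obj (tobj T comodule_obj C);
  coact_counit :
    tunitor T comodule_obj ∘ tmapr T comodule_obj (counit C) ∘ coact
      = idm S comodule_obj;
  coact_comul :
    tassoc T comodule_obj C C ∘ tmapr T comodule_obj (comul C) ∘ coact
      = tmapl T C coact ∘ coact
}.

Definition is_comodule_morphism (P Q : comodule) : {pred hom S P Q} :=
  fun phi => coact Q ∘ phi == tmapl T C phi ∘ coact P.

Lemma tmapl_linear (M N : S) (V : lmodType k) : linear (@tmapl k S T M N V).
Proof.
move=> a f g; apply/esym/tlift_uniq => v.
by rewrite compmPl /tmapl !tliftE /= /tmapl_fun compmPr.
Qed.

Lemma tmapl_comp (M N P : S) (V : lmodType k) (g : hom S N P) (f : hom S M N) :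
  tmapl T V (g ∘ f) = tmapl T V g ∘ tmapl T V f.
Proof.
apply/esym/tlift_uniq => v.
by rewrite /tmapl -compmA tliftE /= /tmapl_fun compmA tliftE /= /tmapl_fun compmA.
Qed.

Lemma tmapl_id (M : S) (V : lmodType k) : tmapl T V (idm S M) = idm S (tobj T M V).
Proof. by apply/esym/tlift_uniq => v /=; rewrite /tmapl_fun comp1m compm1. Qed.

Lemma comodule_morphism_submod (P Q : comodule) :
  submod_closed (@is_comodule_morphism P Q).
Proof.
split=> [|a f g]; rewrite !unfold_in /is_comodule_morphism.
  have t0 : tmapl T C (0 : hom S P Q) = 0.
    by apply/esym/tlift_uniq => v; rewrite /= /tmapl_fun comp0m compm0.
  by rewrite t0 compm0 comp0m.
by move=> /eqP hf /eqP hg; rewrite tmapl_linear compmPl compmPr hf hg.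
Qed.

HB.instance Definition _ (P Q : comodule) :=
  GRing.isSubmodClosed.Build k (hom S P Q) (@is_comodule_morphism P Q)
    (comodule_morphism_submod P Q).

Record comodule_hom (P Q : comodule) := ComoduleHom {
  comodule_hom_val :> hom S P Q;
  comodule_homP : comodule_hom_val \in @is_comodule_morphism P Q
}.

HB.instance Definition _ P Q := [isSub for @comodule_hom_val P Q].
HB.instance Definition _ P Q := [Choice of comodule_hom P Q by <:].
HB.instance Definition _ P Q :=
  [SubChoice_isSubLmodule of comodule_hom P Q by <:].

Lemma comodule_id_proof (P : comodule) : idm S P \in @is_comodule_morphism P P.
Proof. by rewrite unfold_in /is_comodule_morphism tmapl_id comp1m compm1. Qed.

Lemma comodule_comp_proof (P Q R : comodule)
    (g : comodule_hom Q R) (f : comodule_hom P Q) :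
  (g : hom S Q R) ∘ (f : hom S P Q) \in @is_comodule_morphism P R.
Proof.
have /eqP hg := comodule_homP g; have /eqP hf := comodule_homP f.
rewrite unfold_in /is_comodule_morphism tmapl_comp.
by rewrite compmA hg -compmA hf compmA.
Qed.

Definition comodule_id (P : comodule) : comodule_hom P P :=
  ComoduleHom (comodule_id_proof P).

Definition comodule_comp (P Q R : comodule)
    (g : comodule_hom Q R) (f : comodule_hom P Q) : comodule_hom P R :=
  ComoduleHom (comodule_comp_proof g f).

Lemma comodule_compA (P Q R L : comodule) (h : comodule_hom R L)
    (g : comodule_hom Q R) (f : comodule_hom P Q) :
  comodule_comp h (comodule_comp g f) = comodule_comp (comodule_comp h g) f.
Proof. by apply: val_inj; rewrite /= compmA. Qed.

Lemma comodule_comp1m (P Q : comodule) (f : comodule_hom P Q) :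
  comodule_comp (comodule_id Q) f = f.
Proof. by apply: val_inj; rewrite /= comp1m. Qed.

Lemma comodule_compm1 (P Q : comodule) (f : comodule_hom P Q) :
  comodule_comp f (comodule_id P) = f.
Proof. by apply: val_inj; rewrite /= compm1. Qed.

Lemma comodule_comp_bilinear (P Q R : comodule) :
  bilinear_for *:%R *:%R (@comodule_comp P Q R).
Proof.
split=> [f a g g'|g a f f']; apply: val_inj; first exact: compmPl.
exact: compmPr.
Qed.

Definition comodule_category : linear_category k :=
  LinearCategory comodule_compA comodule_comp1m comodule_compm1
    comodule_comp_bilinear.

End Comodules.

(* In a cocomplete abelian category the tensoring exists: M (x) V is the
   cokernel of the map imposing linearity on the coproduct of V copies of M. *)
Section TensoringExists.
Variables (k : fieldType) (S : linear_category k).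

Definition discrete (I : Type) : small_category.
Proof.
refine (@SmallCategory I (fun i j => i = j) (fun i => erefl i)
  (fun i j l v u => etrans u v) _ _ _).
- by move=> i j l m w v u; case: _ / w.
- by move=> i j u; case: _ / u.
- by move=> i j u; case: _ / u.
Defined.

Definition discrete_diagram (I : Type) (X : I -> S) : diagram S (discrete I).
Proof.
refine (@Diagram k S (discrete I) X
  (fun i j u => ecast z (hom S (X i) (X z)) u (idm S (X i))) _ _).
- by [].
- by move=> i j l v u; case: _ / v; case: _ / u => /=; rewrite comp1m.
Defined.

Lemma coproduct_exists (I : Type) (X : I -> S) : cocomplete S ->
  exists (P : S) (c : forall i, hom S (X i) P),
    forall (Y : S) (d : forall i, hom S (X i) Y),
      exists! h : hom S P Y, forall i, h ∘ c i = d i.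
Proof.
move=> /(_ _ (discrete_diagram X)) [P [c [_ cP]]].
exists P, c => Y d; apply: cP => i j u.
by case: _ / u => /=; rewrite compm1.
Qed.

Lemma universal_arrow_exists (M : S) (V : lmodType k) :
  abelian S -> cocomplete S ->
  exists (P : S) (u : {linear V -> hom S M P}),
    forall (N : S) (f : {linear V -> hom S M N}),
      exists! h : hom S P N, forall v, h ∘ u v = f v.
Proof.
move=> abS ccS.
have [A [c cP]] := coproduct_exists (fun _ : V => M) ccS.
have [B [d dP]] := coproduct_exists (fun _ : k * V * V => M) ccS.
have [r [rE _]] := dP A (fun p => c (p.1.1 *: p.1.2 + p.2) -
                                  (p.1.1 *: c p.1.2 + c p.2)).
have [Q [q [q0 qP]]] := abelian_cokernel abS r.
pose u (v : V) : hom S M Q := q ∘ c v.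
have u_lin : linear u.
  move=> a v w; rewrite /u -compmPr; apply/eqP; rewrite -subr_eq0 -compmBr.
  by rewrite -(rE (a, v, w)) compmA q0 comp0m.
pose uL : {linear V -> hom S M Q} := HB.pack u (GRing.isLinear.Build _ _ _ _ u u_lin).
exists Q, uL => N f.
have [g [gE gU]] := cP N f.
have gr0 : g ∘ r = 0.
  have [z [zE zU]] := dP N (fun=> 0).
  have <- : z = 0 by apply: zU => p; rewrite comp0m.
  by apply/esym/zU => p; rewrite -compmA rE compmBr compmPr !gE linearP subrr.
have [h [hE hU]] := qP N g gr0.
exists h; split=> [v|h' h'E].
  by rewrite /= /u compmA hE gE.
apply: hU; apply/esym/gU => v.
by rewrite -compmA -h'E.
Qed.

Lemma tensoring_exists : abelian S -> cocomplete S -> inhabited (tensoring S).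
Proof.
move=> abS ccS.
pose ua M V := cid (@universal_arrow_exists M V abS ccS).
pose P M V := projT1 (ua M V).
pose u' M V := cid (projT2 (ua M V)).
pose u M V := projT1 (u' M V).
pose l' M V N f := cid (projT2 (u' M V) N f).
have lE M V N f : unique _ (projT1 (l' M V N f)) := projT2 (l' M V N f).
constructor; apply: (@Tensoring k S P u (fun M V N f => projT1 (l' M V N f))).
- by move=> M V N f; case: (lE M V N f).
- by move=> M V N f h hE; case: (lE M V N f) => _ /(_ h hE).
Qed.

End TensoringExists.

(* Main.v *)
From HB Require Import structures.
From mathcomp Require Import all_boot all_algebra.
From mathcomp Require Import boolp.
Require Import Defs.

(* The forgetful functor S^C -> S creates colimits, because a comodule structure
   on a colimit is determined by its restriction to a jointly epic family. It
   creates kernels because - (x) C preserves them: C is the filtered colimit of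
   the spaces k^n mapping to it, - (x) k^n is a finite direct sum, and filtered
   colimits in S are exact. Hence everything except the generator is inherited
   from S.

   For the generator, let G generate S and let h : G -> P with P a comodule.
   By AB5, G is covered by maps e : G -> G such that Delta h e takes its values
   in P (x) k^n for some k^n -> C; the coordinates G -> P of these maps are the
   coefficients of h. The sum of the images of all iterated coefficients of h is
   a subcomodule of P through which h factors, and it is a quotient in S of a
   coproduct A of copies of G that depends on neither P nor h. The quotients of A
   form a set, and so do the comodule structures on each of them; their
   coproduct is a generator of S^C. *)

Set Implicit Arguments.
Unset Strict Implicit.
Unset Printing Implicit Defensive.

Import GRing.Theory.
Local Open Scope ring_scope.
Local Open Scope linear_category_scope.

(** * Abelian categories and filtered colimits *)

Lemma dep_choice (I : Type) (V : I -> Type) (P : forall i, V i -> Prop) :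
  (forall i, exists x, P i x) -> exists f, forall i, P i (f i).
Proof.
by move=> ex; exists (fun i => projT1 (cid (ex i))) => i; case: (cid (ex i)).
Qed.

Section LinearCategory.
Variables (k : fieldType) (S : linear_category k).

Lemma compmZl (X Y Z : S) (a : k) (g : hom S Y Z) (f : hom S X Y) :
  (a *: g) ∘ f = a *: (g ∘ f).
Proof. by rewrite -[a *: g]addr0 compmPl comp0m addr0. Qed.

Lemma compmZr (X Y Z : S) (a : k) (g : hom S Y Z) (f : hom S X Y) :
  g ∘ (a *: f) = a *: (g ∘ f).
Proof. by rewrite -[a *: f]addr0 compmPr compm0 addr0. Qed.

Lemma compmDl (X Y Z : S) (g g' : hom S Y Z) (f : hom S X Y) :
  (g + g') ∘ f = g ∘ f + g' ∘ f.
Proof. by rewrite -[g]scale1r compmPl !scale1r. Qed.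

Lemma compmDr (X Y Z : S) (g : hom S Y Z) (f f' : hom S X Y) :
  g ∘ (f + f') = g ∘ f + g ∘ f'.
Proof. by rewrite -[f]scale1r compmPr !scale1r. Qed.

Lemma compm_suml (X Y Z : S) (I : Type) (r : seq I) (g : I -> hom S Y Z)
    (f : hom S X Y) :
  (\sum_(i <- r) g i) ∘ f = \sum_(i <- r) g i ∘ f.
Proof.
elim: r => [|i r IHr]; first by rewrite !big_nil comp0m.
by rewrite !big_cons compmDl IHr.
Qed.

Lemma compm_sumr (X Y Z : S) (I : Type) (r : seq I) (g : hom S Y Z)
    (f : I -> hom S X Y) :
  g ∘ (\sum_(i <- r) f i) = \sum_(i <- r) g ∘ f i.
Proof.
elim: r => [|i r IHr]; first by rewrite !big_nil compm0.
by rewrite !big_cons compmDr IHr.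
Qed.

Lemma mono0 (X Y : S) (f : hom S X Y) :
  (forall (W : S) (g : hom S W X), f ∘ g = 0 -> g = 0) -> is_mono f.
Proof.
move=> f0 W g h fgh; apply/eqP; rewrite -subr_eq0; apply/eqP/f0.
by rewrite compmBr fgh subrr.
Qed.

Lemma epi0 (X Y : S) (f : hom S X Y) :
  (forall (W : S) (g : hom S Y W), g ∘ f = 0 -> g = 0) -> is_epi f.
Proof.
move=> f0 W g h fgh; apply/eqP; rewrite -subr_eq0; apply/eqP/f0.
by rewrite compmBl fgh subrr.
Qed.

Lemma mono_eq0 (X Y W : S) (f : hom S X Y) (g : hom S W X) :
  is_mono f -> f ∘ g = 0 -> g = 0.
Proof. by move=> mf fg; apply: mf; rewrite fg compm0. Qed.

Lemma epi_eq0 (X Y W : S) (f : hom S X Y) (g : hom S Y W) :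
  is_epi f -> g ∘ f = 0 -> g = 0.
Proof. by move=> ef gf; apply: ef; rewrite gf comp0m. Qed.

Lemma kernel_mono (K X Y : S) (f : hom S X Y) (i : hom S K X) :
  is_kernel f i -> is_mono i.
Proof.
move=> [fi ki] W g h igh.
have /ki[l [_ lU]] : f ∘ (i ∘ g) = 0 by rewrite compmA fi comp0m.
by rewrite -(lU g) // -(lU h).
Qed.

Lemma cokernel_epi (X Y Q : S) (f : hom S X Y) (p : hom S Y Q) :
  is_cokernel f p -> is_epi p.
Proof.
move=> [pf kp] W g h gph.
have /kp[l [_ lU]] : g ∘ p ∘ f = 0 by rewrite -compmA pf compm0.
by rewrite -(lU g) // -(lU h).
Qed.

Lemma kernel_lift (K X Y W : S) (f : hom S X Y) (i : hom S K X) (g : hom S W X) :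
  is_kernel f i -> f ∘ g = 0 -> exists h, i ∘ h = g.
Proof. by move=> [_ ki] /ki[h [hE _]]; exists h. Qed.

Lemma cokernel_desc (X Y Q W : S) (f : hom S X Y) (p : hom S Y Q) (g : hom S Y W) :
  is_cokernel f p -> g ∘ f = 0 -> exists h, h ∘ p = g.
Proof. by move=> [_ kp] /kp[h [hE _]]; exists h. Qed.

Lemma is_kernelI (K X Y : S) (f : hom S X Y) (i : hom S K X) :
  f ∘ i = 0 -> is_mono i ->
  (forall (W : S) (g : hom S W X), f ∘ g = 0 -> exists h, i ∘ h = g) ->
  is_kernel f i.
Proof.
move=> fi mi li; split=> // W g /li[h hE]; exists h; split=> // h' h'E.
by apply: mi; rewrite hE h'E.
Qed.

Lemma is_cokernelI (X Y Q : S) (f : hom S X Y) (p : hom S Y Q) :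
  p ∘ f = 0 -> is_epi p ->
  (forall (W : S) (g : hom S Y W), g ∘ f = 0 -> exists h, h ∘ p = g) ->
  is_cokernel f p.
Proof.
move=> pf ep lp; split=> // W g /lp[h hE]; exists h; split=> // h' h'E.
by apply: ep; rewrite hE h'E.
Qed.

(** By abelianness [f] is a kernel of some [g], and [g] factors through [p], so whatever [p] kills
    is also killed by [g]. *)
Lemma mono_kernel_cokernel (X Y Q : S) (f : hom S X Y) (p : hom S Y Q) :
  abelian S -> is_mono f -> is_cokernel f p -> is_kernel p f.
Proof.
move=> abS mf pf; have [Z [g gf]] := abelian_mono abS mf.
have [l lE] := cokernel_desc pf (proj1 gf).
apply: is_kernelI => // [|W h ph]; first by case: pf.
by apply: (kernel_lift gf); rewrite -lE -compmA ph compm0.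
Qed.

Lemma epi_cokernel_kernel (K X Y : S) (f : hom S X Y) (i : hom S K X) :
  abelian S -> is_epi f -> is_kernel f i -> is_cokernel i f.
Proof.
move=> abS ef fi; have [Z [g gf]] := abelian_epi abS ef.
have [l lE] := kernel_lift fi (proj1 gf).
apply: is_cokernelI => // [|W h hi]; first by case: fi.
by apply: (cokernel_desc gf); rewrite -lE compmA hi comp0m.
Qed.

(* If m t = 0 and q = coker t, then the epi q p is a cokernel of some l; l is
   killed by m p, so p itself factors through q p. Hence q is mono and t = 0. *)
Lemma coimage_mono (K X I Y : S) (g : hom S X Y) (i : hom S K X) (p : hom S X I)
    (m : hom S I Y) :
  abelian S -> is_kernel g i -> is_cokernel i p -> m ∘ p = g -> is_mono m.
Proof.
move=> abS gi ip mp; have ep := cokernel_epi ip.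
apply: mono0 => W t mt.
have [Q [q tq]] := abelian_cokernel abS t.
have eqp : is_epi (q ∘ p).
  apply: epi0 => V h; rewrite compmA => /(epi_eq0 ep).
  exact: (epi_eq0 (cokernel_epi tq)).
have [Z [l lqp]] := abelian_epi abS eqp.
have [m' m'q] := cokernel_desc tq mt.
have gl : g ∘ l = 0.
  by rewrite -mp -m'q -[_ ∘ q ∘ p]compmA -compmA (proj1 lqp) compm0.
have [l' l'E] := kernel_lift gi gl.
have pl : p ∘ l = 0 by rewrite -l'E compmA (proj1 ip) comp0m.
have [r rE] := cokernel_desc lqp pl.
have rq : r ∘ q = idm S I by apply: ep; rewrite -compmA rE comp1m.
by rewrite -[t]comp1m -rq -compmA (proj1 tq) compm0.
Qed.

Lemma coimage_exists (X Y : S) (g : hom S X Y) : abelian S ->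
  exists (I : S) (p : hom S X I) (m : hom S I Y),
    [/\ is_epi p, is_mono m & m ∘ p = g].
Proof.
move=> abS; have [K [i gi]] := abelian_kernel abS g.
have [I [p ip]] := abelian_cokernel abS i.
have [m mE] := cokernel_desc ip (proj1 gi).
exists I, p, m; split=> //; first exact: cokernel_epi ip.
exact: coimage_mono gi ip mE.
Qed.

Lemma colimit_eq (J : small_category) (F : diagram S J) (X Y : S)
    (c : forall j, hom S (F j) X) (g h : hom S X Y) :
  is_colimit c -> (forall j, g ∘ c j = h ∘ c j) -> g = h.
Proof.
move=> [cc cU] gh.
have [|l [_ lU]] := cU Y (fun j => h ∘ c j).
  by move=> i j u; rewrite -compmA cc.
by rewrite -(lU h) // -(lU g).
Qed.

Lemma colimit_desc (J : small_category) (F : diagram S J) (X Y : S)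
    (c : forall j, hom S (F j) X) (d : forall j, hom S (F j) Y) :
  is_colimit c -> is_cocone d -> exists h, forall j, h ∘ c j = d j.
Proof. by move=> [_ cU] /cU[h [hE _]]; exists h. Qed.

Lemma colimit_map (J : small_category) (F F' : diagram S J)
    (a : forall j, hom S (F j) (F' j)) (X Y : S)
    (c : forall j, hom S (F j) X) (d : forall j, hom S (F' j) Y) :
  is_natural a -> is_colimit c -> is_cocone d ->
  exists h, forall j, h ∘ c j = d j ∘ a j.
Proof.
move=> na cc cd; apply: (colimit_desc cc) => i j u.
by rewrite -compmA na compmA cd.
Qed.

Lemma is_colimitI (J : small_category) (F : diagram S J) (X : S)
    (c : forall j, hom S (F j) X) :
  is_cocone c ->
  (forall (Y : S) (g h : hom S X Y), (forall j, g ∘ c j = h ∘ c j) -> g = h) ->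
  (forall (Y : S) (d : forall j, hom S (F j) Y), is_cocone d ->
    exists h, forall j, h ∘ c j = d j) ->
  is_colimit c.
Proof.
move=> cc ce cd; split=> // Y d /cd[h hE]; exists h; split=> // h' h'E.
by apply: ce => j; rewrite hE h'E.
Qed.

Lemma kernel_diagram (J : small_category) (F F' : diagram S J)
    (a : forall j, hom S (F j) (F' j)) :
  abelian S -> is_natural a ->
  exists (K : diagram S J) (i : forall j, hom S (K j) (F j)),
    is_natural i /\ forall j, is_kernel (a j) (i j).
Proof.
move=> abS na.
pose K j := projT1 (cid (abelian_kernel abS (a j))).
pose i j : hom S (K j) (F j) := projT1 (cid (projT2 (cid (abelian_kernel abS (a j))))).
have ki j : is_kernel (a j) (i j).
  exact: (projT2 (cid (projT2 (cid (abelian_kernel abS (a j)))))).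
have mi j := kernel_mono (ki j).
(* All arrows of [J] are packed into one type so that every transition map is chosen at once;
   functoriality then holds because each [i j] is mono. *)
have /dep_choice[m mE] (p : {x : J * J & shom J x.1 x.2}) :
    exists h, i (tag p).2 ∘ h = dmap F (tagged p) ∘ i (tag p).1.
  apply: (kernel_lift (ki _)).
  by rewrite compmA na -compmA (proj1 (ki _)) compm0.
have {}mE x y u : i y ∘ m (existT _ (x, y) u) = dmap F u ∘ i x := mE (existT _ (x, y) u).
unshelve eexists.
  apply: (@Diagram k S J K (fun x y u => m (existT _ (x, y) u))).
  - by move=> x; apply: mi; rewrite mE dmap_id comp1m compm1.
  - move=> x y z v u; apply: mi.
    by rewrite mE dmap_comp compmA mE -!compmA mE.
by exists i; split=> // x y u; rewrite mE.
Qed.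

Lemma cokernel_diagram (J : small_category) (F F' : diagram S J)
    (a : forall j, hom S (F j) (F' j)) :
  abelian S -> is_natural a ->
  exists (Q : diagram S J) (p : forall j, hom S (F' j) (Q j)),
    is_natural p /\ forall j, is_cokernel (a j) (p j).
Proof.
move=> abS na.
pose Q j := projT1 (cid (abelian_cokernel abS (a j))).
pose p j : hom S (F' j) (Q j) :=
  projT1 (cid (projT2 (cid (abelian_cokernel abS (a j))))).
have kp j : is_cokernel (a j) (p j).
  exact: (projT2 (cid (projT2 (cid (abelian_cokernel abS (a j)))))).
have ep j := cokernel_epi (kp j).
have /dep_choice[m mE] (x : {x : J * J & shom J x.1 x.2}) :
    exists h, h ∘ p (tag x).1 = p (tag x).2 ∘ dmap F' (tagged x).
  apply: (cokernel_desc (kp _)).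
  by rewrite -compmA -na compmA (proj1 (kp _)) comp0m.
have {}mE x y u : m (existT _ (x, y) u) ∘ p x = p y ∘ dmap F' u := mE (existT _ (x, y) u).
unshelve eexists.
  apply: (@Diagram k S J Q (fun x y u => m (existT _ (x, y) u))).
  - by move=> x; apply: ep; rewrite mE dmap_id comp1m compm1.
  - move=> x y z v u; apply: ep.
    by rewrite mE dmap_comp -compmA mE !compmA mE.
by exists p; split=> // x y u; rewrite mE.
Qed.

Definition constant_diagram (J : small_category) (X : S) : diagram S J.
Proof.
by refine (@Diagram k S J (fun=> X) (fun _ _ _ => idm S X) _ _) => // *;
  rewrite comp1m.
Defined.

Lemma constant_cocone (J : small_category) (X Y : S)
    (d : forall j, hom S (constant_diagram J X j) Y) (i j : J) :
  filtered J -> is_cocone d -> d i = d j.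
Proof.
move=> fJ cd; have [l [[u] [v]]] := filtered_object fJ i j.
by rewrite -(cd _ _ u) -(cd _ _ v).
Qed.

Lemma constant_colimit (J : small_category) (X : S) : filtered J ->
  is_colimit (fun j => idm S X : hom S (constant_diagram J X j) X).
Proof.
move=> fJ; have [j0] := filtered_inhabited fJ.
apply: is_colimitI => [i j u|Y g h gh|Y d cd]; first by rewrite compm1.
  by have := gh j0; rewrite !compm1.
by exists (d j0) => j; rewrite compm1; exact: (constant_cocone j0 j fJ cd).
Qed.

(* The kernels of the maps a j, glued along J, cover the kernel of f: apply
   AB5 to ker (a j) -> F j -> im (a j) and to im (a j) -> Y -> coker (a j). *)
Lemma filtered_kernel_cover (J : small_category) (F : diagram S J) (X Y : S)
    (c : forall j, hom S (F j) X) (a : forall j, hom S (F j) Y) (f : hom S X Y) :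
  abelian S -> cocomplete S -> exact_filtered_colimits S -> filtered J ->
  is_colimit c -> is_cocone a -> (forall j, f ∘ c j = a j) ->
  forall (W Z : S) (s : hom S W X) (u : hom S X Z), f ∘ s = 0 ->
  (forall j (V : S) (b : hom S V (F j)), a j ∘ b = 0 -> u ∘ c j ∘ b = 0) ->
  u ∘ s = 0.
Proof.
move=> abS ccS exS fJ cc ca fE W Z s u fs ub.
pose Yd := constant_diagram J Y.
have na : @is_natural _ _ J F Yd a by move=> i j w; rewrite ca comp1m.
have [K [i [ni ki]]] := kernel_diagram abS na.
have [I [p [np kp]]] := cokernel_diagram abS ni.
have /dep_choice[m mE] j : exists h, h ∘ p j = a j.
  exact: (cokernel_desc (kp j) (proj1 (ki j))).
have mm j : is_mono (m j) by apply: coimage_mono (ki j) (kp j) (mE j).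
have ep j := cokernel_epi (kp j).
have nm : @is_natural _ _ J I Yd m.
  by move=> x y w; apply: ep; rewrite -compmA -np compmA mE ca comp1m mE.
have [R [q [nq kq]]] := cokernel_diagram abS nm.
have [Kc [kc cK]] := ccS J K.
have [Ic [ic cI]] := ccS J I.
have [Rc [rc cR]] := ccS J R.
have [i' i'E] := colimit_map ni cK (proj1 cc).
have [p' p'E] := colimit_map np cc (proj1 cI).
have cY := constant_colimit Y fJ.
have [m' m'E] := colimit_map nm cI (proj1 cY).
have [q' q'E] := colimit_map nq cY (proj1 cR).
have [ki' _] : short_exact i' p'.
  apply: (exS J fJ K F I i p ni np _ _ _ _ kc c ic) => // j.
  split=> //; apply: mono_kernel_cokernel => //.
  exact: kernel_mono (ki j).
have [km' _] : short_exact m' q'.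
  apply: (exS J fJ I Yd R m q nm nq _ _ _ _ ic _ rc cI cY cR) => // j.
  by split=> //; apply: mono_kernel_cokernel.
have m'p' : m' ∘ p' = f.
  apply: (colimit_eq cc) => j.
  by rewrite -compmA p'E compmA m'E comp1m mE fE.
have p's : p' ∘ s = 0.
  by apply: (mono_eq0 (kernel_mono km')); rewrite compmA m'p'.
have [s' <-] := kernel_lift ki' p's.
rewrite compmA; suff -> : u ∘ i' = 0 by rewrite comp0m.
apply: (colimit_eq cK) => j; rewrite comp0m -compmA i'E compmA.
by apply: ub; case: (ki j).
Qed.

End LinearCategory.

Section FilteredCover.
Variables (k : fieldType) (S : linear_category k).
Hypotheses (abS : abelian S) (ccS : cocomplete S) (exS : exact_filtered_colimits S).

(* The pullback of c j along h is the kernel of h p1 - c j p2 on W (+) F j, and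
   these kernels cover that of [h, -1] on W (+) X, which is the graph of h. *)
Lemma filtered_pullback_cover (J : small_category) (F : diagram S J) (X : S)
    (c : forall j, hom S (F j) X) (W Z : S) (h : hom S W X) (u : hom S W Z) :
  filtered J -> is_colimit c ->
  (forall j (V : S) (b : hom S V W) (t : hom S V (F j)),
     h ∘ b = c j ∘ t -> u ∘ b = 0) ->
  u = 0.
Proof.
move=> fJ cX ub; have [j0] := filtered_inhabited fJ.
have [B' [I1 [I2 [P1 [P2 [PI1 PI2 PI12 PI21 PI]]]]]] := abelian_biproduct abS W X.
have /dep_choice[B /dep_choice[i1 /dep_choice[i2 /dep_choice[p1 /dep_choice[p2 bp]]]]]
  j := abelian_biproduct abS W (F j).
have pi1 j : p1 j ∘ i1 j = idm S W by case: (bp j).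
have pi2 j : p2 j ∘ i2 j = idm S (F j) by case: (bp j).
have pi12 j : p1 j ∘ i2 j = 0 by case: (bp j).
have pi21 j : p2 j ∘ i1 j = 0 by case: (bp j).
have pij j : i1 j ∘ p1 j + i2 j ∘ p2 j = idm S (B j) by case: (bp j).
(* [D j] is W ⊕ F j, with the identity on [W] and the transition maps of [F] on the other
   summand. *)
unshelve epose (D := _ : diagram S J).
  unshelve refine (@Diagram k S J B
    (fun i j w => i1 j ∘ p1 i + i2 j ∘ dmap F w ∘ p2 i) _ _).
  - by move=> j; rewrite dmap_id compm1 pij.
  - move=> i j l v w; rewrite dmap_comp compmDl !compmDr !compmA.
    rewrite -[_ ∘ p1 j ∘ i1 j]compmA -[_ ∘ p1 j ∘ i2 j]compmA pi1 pi12.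
    rewrite -[_ ∘ p2 j ∘ i1 j]compmA -[_ ∘ p2 j ∘ i2 j]compmA pi21 pi2.
    by rewrite !compm1 !compm0 !comp0m addr0 add0r.
pose c' j : hom S (D j) B' := I1 ∘ p1 j + I2 ∘ c j ∘ p2 j.
have c'1 j : c' j ∘ i1 j = I1.
  by rewrite compmDl -!compmA pi1 pi21 !compm0 compm1 addr0.
have c'2 j : c' j ∘ i2 j = I2 ∘ c j.
  by rewrite compmDl -!compmA pi12 pi2 compm0 compm1 add0r.
have Dext j Y (g g' : hom S (D j) Y) :
    g ∘ i1 j = g' ∘ i1 j -> g ∘ i2 j = g' ∘ i2 j -> g = g'.
  move=> g1 g2; rewrite -[g]compm1 -[g']compm1 -pij !compmDr !compmA.
  by rewrite g1 g2.
have D1 i j (w : shom J i j) : dmap D w ∘ i1 i = i1 j.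
  by rewrite compmDl -!compmA pi1 pi21 !compm0 compm1 addr0.
have D2 i j (w : shom J i j) : dmap D w ∘ i2 i = i2 j ∘ dmap F w.
  by rewrite compmDl -!compmA pi12 pi2 compm0 compm1 add0r.
(* The colimit of [D] is W ⊕ X: the [W]-component of a cocone does not depend on the index, since
   any two indices have a common successor. *)
have cB' : @is_colimit _ _ _ D B' c'.
  apply: is_colimitI.
  - move=> i j w; apply: Dext; rewrite -compmA ?D1 ?D2 ?c'1 //.
    by rewrite compmA !c'2 -compmA (proj1 cX).
  - move=> Y g g' gg; rewrite -[g]compm1 -[g']compm1 -PI !compmDr !compmA.
    have -> : g ∘ I2 = g' ∘ I2.
      by apply: (colimit_eq cX) => j; rewrite -!compmA -c'2 !compmA gg.
    by rewrite -(c'1 j0) !compmA gg.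
  - move=> Y d cd.
    have d1 j : d j ∘ i1 j = d j0 ∘ i1 j0.
      have [l [[v] [w]]] := filtered_object fJ j j0.
      by rewrite -(cd _ _ v) -(cd _ _ w) -!compmA !D1.
    have [|l lE] := colimit_desc (d := fun j => d j ∘ i2 j) cX.
      by move=> i j w; rewrite /= -compmA -D2 compmA cd.
    exists (d j0 ∘ i1 j0 ∘ P1 + l ∘ P2) => j; apply: Dext.
      rewrite -compmA c'1 d1 compmDl -!compmA PI1 PI21 !compm0 addr0.
      by rewrite compm1.
    by rewrite -compmA c'2 compmDl -lE -!compmA ![_ ∘ (I2 ∘ _)]compmA
      PI12 PI2 !comp0m !compm0 add0r comp1m.
pose a j : hom S (D j) X := h ∘ p1 j - c j ∘ p2 j.
have aE j : (h ∘ P1 - P2) ∘ c' j = a j.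
  apply: Dext; rewrite -compmA ?c'1 ?c'2 !compmBl -!compmA ?pi1 ?pi21 ?pi12 ?pi2.
    by rewrite PI1 PI21 !compm0 compm1.
  by rewrite ![_ ∘ (I2 ∘ _)]compmA PI12 PI2 comp0m !compm0 comp1m compm1.
have ca : @is_cocone _ _ _ D X a.
  by move=> i j w; rewrite -!aE -compmA (proj1 cB').
(* [I1 + I2 ∘ h] is the graph of [h], which [h ∘ P1 - P2] kills; composed with it, [u ∘ P1] becomes
   [u]. *)
have := @filtered_kernel_cover _ _ _ D _ _ c' a _ abS ccS exS fJ cB' ca aE W Z
  (I1 + I2 ∘ h) (u ∘ P1).
rewrite !compmDr !compmBl -!compmA ![_ ∘ (I2 ∘ _)]compmA.
rewrite PI1 PI21 PI12 PI2 !comp0m !compm0 comp1m !compm1 subr0 add0r addr0.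
apply; first by rewrite subrr.
move=> j V b; rewrite /a compmBl -!compmA => /eqP; rewrite subr_eq0 => /eqP ab.
have -> : P1 ∘ (c' j ∘ b) = p1 j ∘ b.
  rewrite compmA; congr (_ ∘ b); apply: Dext.
    by rewrite -compmA c'1 PI1 pi1.
  by rewrite -compmA c'2 compmA PI12 pi12 comp0m.
exact: ub ab.
Qed.

End FilteredCover.

(** * Exactness of the tensor product *)

Section Tensoring.
Variables (k : fieldType) (S : linear_category k) (T : tensoring S).

Lemma tlift_exists (M N : S) (V : lmodType k) (f : V -> hom S M N) :
  linear f -> exists g : hom S (tobj T M V) N, forall v, g ∘ tunit T M V v = f v.
Proof.
move=> lf.
pose fL : {linear V -> hom S M N} := HB.pack f (GRing.isLinear.Build _ _ _ _ f lf).
by exists (tlift T fL) => v; rewrite tliftE.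
Qed.

(** Both maps lift the same linear map, and lifts are unique. Equalities of maps out of M ⊗ V are
    tested on elements of [V] in this way. *)
Lemma tobj_ext (M N : S) (V : lmodType k) (g h : hom S (tobj T M V) N) :
  (forall v, g ∘ tunit T M V v = h ∘ tunit T M V v) -> g = h.
Proof.
move=> gh; pose f v := h ∘ tunit T M V v.
have lf : linear f by move=> a v w; rewrite /f linearP compmPr.
pose fL : {linear V -> hom S M N} := HB.pack f (GRing.isLinear.Build _ _ _ _ f lf).
by transitivity (tlift T fL); [|symmetry]; apply: tlift_uniq => v; rewrite ?gh.
Qed.

Lemma tmapr_tunit (M : S) (V W : lmodType k) (f : {linear V -> W}) v :
  tmapr T M f ∘ tunit T M V v = tunit T M W (f v).
Proof. exact: tliftE. Qed.

Lemma tmapl_tunit (M N : S) (V : lmodType k) (phi : hom S M N) v :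
  tmapl T V phi ∘ tunit T M V v = tunit T N V v ∘ phi.
Proof. exact: tliftE. Qed.

Lemma tmaprl (M N : S) (V W : lmodType k) (f : {linear V -> W}) (phi : hom S M N) :
  tmapr T N f ∘ tmapl T V phi = tmapl T W phi ∘ tmapr T M f.
Proof.
apply: tobj_ext => v.
by rewrite -compmA tmapl_tunit compmA tmapr_tunit -compmA tmapr_tunit tmapl_tunit.
Qed.

Lemma tmapl0 (M N : S) (V : lmodType k) : tmapl T V (0 : hom S M N) = 0.
Proof. by apply: tobj_ext => v; rewrite tmapl_tunit compm0 comp0m. Qed.

Lemma tunitor_natural (M N : S) (phi : hom S M N) :
  tunitor T N ∘ tmapl T k^o phi = phi ∘ tunitor T M.
Proof.
apply: tobj_ext => v; rewrite -compmA tmapl_tunit compmA tliftE.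
by rewrite -compmA tliftE /= /tunitor_fun compmZl comp1m compmZr compm1.
Qed.

Lemma tassoc_natural (M N : S) (U V : lmodType k) (phi : hom S M N) :
  tassoc T N U V ∘ tmapl T (tensor U V) phi
    = tmapl T V (tmapl T U phi) ∘ tassoc T M U V.
Proof.
apply: tobj_ext => t.
rewrite -compmA tmapl_tunit compmA tliftE -compmA tliftE /=.
(* Both sides are sums over the same representative of [t], so they are compared one pair at a
   time. *)
rewrite /tensor_lift /formal_eval compm_suml compm_sumr.
apply: eq_bigr => -[u v] _ /=.
by rewrite /tassoc_pure -compmA -(tmapl_tunit phi) !compmA tmapl_tunit.
Qed.

End Tensoring.

(** * Tensoring with k^n, and cokernels *)

Section Coordinates.
Variable k : fieldType.

Definition row_coord n (i : 'I_n) (x : 'rV[k]_n) : k^o := x 0 i.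

Lemma row_coord_linear n (i : 'I_n) : linear (row_coord i).
Proof. by move=> a x y; rewrite /row_coord !mxE. Qed.

HB.instance Definition _ n (i : 'I_n) :=
  GRing.isLinear.Build k 'rV[k]_n k^o _ (row_coord i) (row_coord_linear i).

Variables (S : linear_category k) (T : tensoring S).

(** The [i]-th projection under the identification of M ⊗ k^n with M^n. *)
Definition tcoord (M : S) n (i : 'I_n) : hom S (tobj T M 'rV[k]_n) M :=
  tlift T (@tunitor_fun k S M \o row_coord i).

Lemma tcoord_tunit (M : S) n (i : 'I_n) x :
  tcoord M i ∘ tunit T M 'rV[k]_n x = x 0 i *: idm S M.
Proof. exact: tliftE. Qed.

Lemma tcoord_natural (M N : S) (phi : hom S M N) n (i : 'I_n) :
  tcoord N i ∘ tmapl T 'rV[k]_n phi = phi ∘ tcoord M i.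
Proof.
apply: tobj_ext => x; rewrite -!compmA tmapl_tunit compmA !tcoord_tunit.
by rewrite compmZl comp1m compmZr compm1.
Qed.

Lemma tcoord_sum (M : S) n :
  idm S (tobj T M 'rV[k]_n)
    = \sum_(i < n) tunit T M 'rV[k]_n (delta_mx 0 i) ∘ tcoord M i.
Proof.
apply: tobj_ext => x; rewrite comp1m compm_suml {1}(row_sum_delta x) linear_sum.
apply: eq_bigr => i _.
by rewrite linearZ -compmA tcoord_tunit compmZr compm1.
Qed.

(** Coordinates are natural and jointly monic, so lifts are found coordinate by coordinate and
    reassembled with [tcoord_sum]. *)
Lemma row_tensor_kernel (K M N : S) (f : hom S M N) (i : hom S K M) n :
  is_kernel f i -> is_kernel (tmapl T 'rV[k]_n f) (tmapl T 'rV[k]_n i).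
Proof.
move=> fi; have mi := kernel_mono fi.
have coord_eq (W M' : S) (g h : hom S W (tobj T M' 'rV[k]_n)) :
    (forall i, tcoord M' i ∘ g = tcoord M' i ∘ h) -> g = h.
  move=> gh; rewrite -[g]comp1m -[h]comp1m tcoord_sum !compm_suml.
  by apply: eq_bigr => j _; rewrite -!compmA gh.
apply: is_kernelI.
- by rewrite -tmapl_comp (proj1 fi) tmapl0.
- move=> W g h gh; apply: coord_eq => j; apply: mi.
  by rewrite !compmA -!tcoord_natural -!compmA gh.
- move=> W g fg.
  have /choice[l lE] j : exists l, i ∘ l = tcoord M j ∘ g.
    by apply: (kernel_lift fi); rewrite compmA -tcoord_natural -compmA fg compm0.
  exists (\sum_(j < n) tunit T K 'rV[k]_n (delta_mx 0 j) ∘ l j).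
  rewrite -[RHS]comp1m tcoord_sum compm_sumr compm_suml.
  apply: eq_bigr => j _.
  by rewrite compmA tmapl_tunit -!compmA lE.
Qed.

(** Maps out of Q ⊗ V are linear families of maps out of [Q]; the factorizations through [p], one
    for each [v], depend linearly on [v] because [p] is epi. *)
Lemma tensor_cokernel (M N Q : S) (f : hom S M N) (p : hom S N Q) (V : lmodType k) :
  is_cokernel f p -> is_cokernel (tmapl T V f) (tmapl T V p).
Proof.
move=> fp; have ep := cokernel_epi fp.
apply: is_cokernelI.
- by rewrite -tmapl_comp (proj1 fp) tmapl0.
- move=> W g h gh; apply: tobj_ext => v; apply: ep.
  by rewrite -!compmA -!tmapl_tunit !compmA gh.
- move=> W g gf.
  have /choice[l lE] v : exists l, l ∘ p = g ∘ tunit T N V v.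
    by apply: (cokernel_desc fp); rewrite -compmA -tmapl_tunit compmA gf comp0m.
  have [|h hE] := @tlift_exists _ _ T Q W V l.
    by move=> a v w; apply: ep; rewrite compmPl !lE linearP compmPr.
  exists h; apply: tobj_ext => v.
  by rewrite -compmA tmapl_tunit compmA hE lE.
Qed.

End Coordinates.

(* The comma category of linear maps k^n -> V, whose colimit is V. *)
Section FinitePresentations.
Variables (k : fieldType) (V : lmodType k).

Definition fd_obj : Type := {n & {linear 'rV[k]_n -> V}}.
Definition fd_hom (i j : fd_obj) : Type :=
  {A : 'M[k]_(tag i, tag j) | forall x, tagged j (x *m A) = tagged i x}.

Lemma fd_hom_eq (i j : fd_obj) (u v : fd_hom i j) : sval u = sval v -> u = v.
Proof. by case: u v => [A hA] [B hB] /= AB; exact: eq_exist. Qed.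

Definition fd_category : small_category.
Proof.
unshelve refine (@SmallCategory fd_obj fd_hom
  (fun i => exist _ 1%:M _) (fun i j l v u => exist _ (sval u *m sval v) _) _ _ _).
- by move=> x /=; rewrite mulmx1.
- by move=> x /=; rewrite mulmxA (svalP v) (svalP u).
- by move=> *; apply: fd_hom_eq; rewrite /= mulmxA.
- by move=> *; apply: fd_hom_eq; rewrite /= mulmx1.
- by move=> *; apply: fd_hom_eq; rewrite /= mul1mx.
Defined.

(** The coproduct of two objects over [V]: an upper bound, in which addition in [V] also becomes
    addition of row vectors. *)
Definition fd_sum (i j : fd_category) : fd_category :=
  existT (fun n => {linear 'rV[k]_n -> V}) (tag i + tag j)%N
    ((tagged i \o lsubmx) \+ (tagged j \o rsubmx)).

Lemma fd_suml (i j : fd_category) x :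
  tagged (fd_sum i j) (row_mx x 0) = tagged i x.
Proof. by rewrite /= row_mxKl row_mxKr linear0 addr0. Qed.

Lemma fd_sumr (i j : fd_category) x :
  tagged (fd_sum i j) (row_mx 0 x) = tagged j x.
Proof. by rewrite /= row_mxKl row_mxKr linear0 add0r. Qed.

Lemma fd_filtered : filtered fd_category.
Proof.
split.
- by constructor; exists 0%N; exact: (\0 : {linear _ -> _}).
- move=> i j; exists (fd_sum i j); split; constructor.
    by exists (row_mx 1%:M 0) => x; rewrite mul_mx_row mulmx1 mulmx0 fd_suml.
  by exists (row_mx 0 1%:M) => x; rewrite mul_mx_row mulmx1 mulmx0 fd_sumr.
(* The matrix [W] has the row space of [A] as its kernel, so it equalizes [u] and [v]; [pinvmx W]
   carries [g] over to its target. *)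
- move=> i [m g] u v; pose A := sval u - sval v; pose W := cokermx A.
  exists (existT (fun n => {linear 'rV[k]_n -> V}) m (g \o mulmxr (pinvmx W))).
  unshelve eexists.
    exists W => x /=; apply/eqP; rewrite -subr_eq0 -linearB.
    (* This difference is killed by [W], hence lies in the row space of [A], on which [g] vanishes
       because [u] and [v] are both maps over [V]. *)
    have /submxP[y ->] : (x *m W *m pinvmx W - x <= A)%MS.
      by rewrite submxE mulmxBl mulmxKpV ?submxMl ?subrr.
    rewrite mulmxBr linearB.
    by have /= -> := svalP u y; have /= -> := svalP v y; rewrite subrr.
  apply: fd_hom_eq => /=; apply/eqP; rewrite -subr_eq0 -mulmxBl.
  by rewrite mulmx_coker.
Qed.

Definition fd_point_fun (v : V) (x : 'rV[k]_1) : V := x 0 0 *: v.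

Lemma fd_point_linear v : linear (fd_point_fun v).
Proof. by move=> a x y; rewrite /fd_point_fun !mxE scalerDl scalerA. Qed.

HB.instance Definition _ v :=
  GRing.isLinear.Build k 'rV[k]_1 V _ (fd_point_fun v) (fd_point_linear v).

Definition fd_point (v : V) : fd_category :=
  existT (fun n => {linear 'rV[k]_n -> V}) 1%N (fd_point_fun v).

(** The arrow k -> k^n over [V] sending 1 to [x]; it links the value of a cocone at [x] to its value
    on a point of [V]. *)
Definition fd_row (j : fd_category) (x : 'rV[k]_(tag j)) :
  shom fd_category (fd_point (tagged j x)) j.
Proof.
exists x => y /=; rewrite [y in y *m x]mx11_scalar mul_scalar_mx linearZ.
by rewrite /fd_point_fun.
Defined.

Variables (S : linear_category k) (T : tensoring S).

Definition fd_diagram (M : S) : diagram S fd_category.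
Proof.
unshelve refine (@Diagram k S fd_category (fun j => tobj T M 'rV[k]_(tag j))
  (fun i j u => tmapr T M (mulmxr (sval u))) _ _).
- by move=> j; apply: tobj_ext => x; rewrite tmapr_tunit /= mulmx1 comp1m.
- move=> i j l v u; apply: tobj_ext => x.
  by rewrite -compmA !tmapr_tunit /= mulmxA.
Defined.

Definition fd_cocone (M : S) (j : fd_category) :
  hom S (fd_diagram M j) (tobj T M V) := tmapr T M (tagged j).

(** By the arrows [fd_row], a cocone is determined by its values at 1 on the objects [fd_point v],
    and these values form a linear family in [v]. *)
Lemma fd_colimit (M : S) : is_colimit (fd_cocone M).
Proof.
have comb (j : fd_category) x y a : tagged j (a *: x + y) = a *: tagged j x + tagged j y.
  exact: linearP.
apply: is_colimitI.
- move=> i j u; apply: tobj_ext => x.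
  by rewrite -compmA !tmapr_tunit /=; congr (tunit _ _ _ _); exact: (svalP u).
- move=> Y g h gh; apply: tobj_ext => v.
  have := congr1 (compm^~ (tunit T M 'rV[k]_1 1)) (gh (fd_point v)).
  by rewrite -!compmA !tmapr_tunit /= /fd_point_fun mxE scale1r.
- move=> Y d cd.
  pose l v : hom S M Y := d (fd_point v) ∘ tunit T M 'rV[k]_1 1.
  have dE j x : d j ∘ tunit T M 'rV[k]_(tag j) x = l (tagged j x).
    by rewrite /l -(cd _ _ (fd_row x)) -compmA tmapr_tunit /= mul1mx.
  have [|h hE] := @tlift_exists _ _ T M Y V l.
    (* Both vectors are lifted to the single object [j], where linearity is that of [tunit]. *)
    move=> a v w; pose j := fd_sum (fd_point v) (fd_point w).
    have vE : v = tagged j (row_mx 1 0).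
      by rewrite fd_suml /= /fd_point_fun mxE scale1r.
    have wE : w = tagged j (row_mx 0 1).
      by rewrite fd_sumr /= /fd_point_fun mxE scale1r.
    by rewrite [in LHS]vE [in LHS]wE -comb -dE linearP compmPr !dE -vE -wE.
  by exists h => j; apply: tobj_ext => x; rewrite -compmA tmapr_tunit hE dE.
Qed.

Lemma fd_natural (M N : S) (phi : hom S M N) :
  @is_natural _ _ _ (fd_diagram M) (fd_diagram N)
    (fun j => tmapl T 'rV[k]_(tag j) phi).
Proof. by move=> i j u; rewrite /= tmaprl. Qed.

Hypotheses (abS : abelian S) (exS : exact_filtered_colimits S).

(** AB5 applied to the exact sequences tensored with k^n, whose colimit over [fd_category] is the
    sequence tensored with [V]. *)
Lemma tensor_short_exact (M N Q : S) (f : hom S M N) (g : hom S N Q) :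
  short_exact f g -> short_exact (tmapl T V f) (tmapl T V g).
Proof.
move=> [kf cg].
apply: (exS fd_filtered (fd_natural f) (fd_natural g) _
          (fd_colimit M) (fd_colimit N) (fd_colimit Q)) => j.
- by split; [exact: row_tensor_kernel|exact: tensor_cokernel].
- by rewrite /fd_cocone tmaprl.
- by rewrite /fd_cocone tmaprl.
Qed.

Lemma tensor_mono (M N : S) (f : hom S M N) : is_mono f -> is_mono (tmapl T V f).
Proof.
move=> mf; have [Q [p fp]] := abelian_cokernel abS f.
have [|kf _] := @tensor_short_exact _ _ _ f p; last exact: kernel_mono kf.
by split=> //; exact: mono_kernel_cokernel.
Qed.

(** Factor [f] through its coimage as [m ∘ p]: tensoring keeps [i], [p] short exact and [m] mono. *)
Lemma tensor_kernel (K M N : S) (f : hom S M N) (i : hom S K M) :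
  is_kernel f i -> is_kernel (tmapl T V f) (tmapl T V i).
Proof.
move=> fi; have mi := kernel_mono fi.
have [I [p ip]] := abelian_cokernel abS i.
have [m mE] := cokernel_desc ip (proj1 fi).
have /tensor_mono mm := coimage_mono abS fi ip mE.
have [|kti _] := @tensor_short_exact _ _ _ i p.
  by split=> //; exact: mono_kernel_cokernel.
apply: is_kernelI => [||W g fg].
- by rewrite -tmapl_comp (proj1 fi) tmapl0.
- exact: tensor_mono.
- apply: (kernel_lift kti); apply: (mono_eq0 mm).
  by rewrite compmA -tmapl_comp mE.
Qed.

End FinitePresentations.

(** * Limits and colimits of comodules *)

Section Coproducts.
Variables (k : fieldType) (S : linear_category k).
Hypothesis ccS : cocomplete S.

(** The empty coproduct is initial, so its identity is zero and every map into it vanishes too. *)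
Lemma cocomplete_zero : exists Z : S, is_zero_object Z.
Proof.
have [Z [c cZ]] := coproduct_exists (fun x : void => of_void S x) ccS.
have Z0 (X : S) (f : hom S Z X) : f = 0.
  have [h [_ hU]] := cZ X (fun x => of_void _ x).
  by transitivity h; [symmetry|]; apply: hU; case.
exists Z; split=> // X f.
by rewrite -[f]comp1m (Z0 _ (idm S Z)) comp0m.
Qed.

Lemma cocomplete_biproduct (X Y : S) :
  exists (B : S) i1 i2 p1 p2, @is_biproduct k S X Y B i1 i2 p1 p2.
Proof.
have [B [c cB]] := coproduct_exists (fun b : bool => if b then X else Y) ccS.
have desc (W : S) (f : hom S X W) (g : hom S Y W) :
    exists h : hom S B W, h ∘ c true = f /\ h ∘ c false = g.
  have [h [hE _]] := cB W (fun b => if b return hom S (if b then X else Y) W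
                                    then f else g).
  by exists h; rewrite (hE true) (hE false).
have [p1 [p1X p1Y]] := desc _ (idm S X) 0.
have [p2 [p2X p2Y]] := desc _ 0 (idm S Y).
exists B, (c true), (c false), p1, p2; split=> //.
have [h [_ hU]] := cB B c.
transitivity h; [symmetry|]; apply: hU => -[]; rewrite ?comp1m //.
  by rewrite compmDl -!compmA p1X p2X compm1 compm0 addr0.
by rewrite compmDl -!compmA p1Y p2Y compm1 compm0 add0r.
Qed.

End Coproducts.

Section Comodules.
Variables (k : fieldType) (S : linear_category k) (T : tensoring S).
Variable C : coalgebra k.
Local Notation SC := (comodule_category T C).
Local Notation comod := (comodule T C).

Definition cval (P Q : SC) (f : hom SC P Q) : hom S (P : comod) (Q : comod) :=
  comodule_hom_val f.

Lemma cval_inj (P Q : SC) (f g : hom SC P Q) : cval f = cval g -> f = g.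
Proof. exact: val_inj. Qed.

Lemma cval_comp (P Q R : SC) (g : hom SC Q R) (f : hom SC P Q) :
  cval (g ∘ f) = cval g ∘ cval f.
Proof. by []. Qed.

Lemma cval_id (P : SC) : cval (idm SC P) = idm S (P : comod).
Proof. by []. Qed.

Lemma cval0 (P Q : SC) : cval (0 : hom SC P Q) = 0.
Proof. by []. Qed.

Lemma coact_cval (P Q : SC) (f : hom SC P Q) :
  coact Q ∘ cval f = tmapl T C (cval f) ∘ coact P.
Proof. by apply/eqP; exact: comodule_homP f. Qed.

Lemma cval_exists (P Q : SC) (f : hom S (P : comod) (Q : comod)) :
  coact Q ∘ f = tmapl T C f ∘ coact P -> exists g : hom SC P Q, cval g = f.
Proof. by move=> /eqP fE; exists (@ComoduleHom _ _ _ _ P Q f fE). Qed.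

Definition is_coaction (X : S) (d : hom S X (tobj T X C)) : Prop :=
  tunitor T X ∘ tmapr T X (counit C) ∘ d = idm S X /\
  tassoc T X C C ∘ tmapr T X (comul C) ∘ d = tmapl T C d ∘ d.

Definition coaction_comodule (X : S) (d : hom S X (tobj T X C))
    (ax : is_coaction d) : SC :=
  Comodule (proj1 ax) (proj2 ax).

Lemma counit_natural (X Y : S) (f : hom S X Y) :
  tunitor T Y ∘ tmapr T Y (counit C) ∘ tmapl T C f
    = f ∘ (tunitor T X ∘ tmapr T X (counit C)).
Proof. by rewrite -compmA tmaprl compmA tunitor_natural compmA. Qed.

Lemma comul_natural (X Y : S) (f : hom S X Y) :
  tassoc T Y C C ∘ tmapr T Y (comul C) ∘ tmapl T C f
    = tmapl T C (tmapl T C f) ∘ (tassoc T X C C ∘ tmapr T X (comul C)).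
Proof. by rewrite -compmA tmaprl compmA tassoc_natural compmA. Qed.

(** By naturality the axioms for [d], precomposed with [c i], become those of [F i]. This yields the
    coactions on colimits and quotients. *)
Lemma epic_coaction (I : Type) (F : I -> SC) (X : S)
    (c : forall i, hom S (F i : comod) X) (d : hom S X (tobj T X C)) :
  (forall (Y : S) (g h : hom S X Y), (forall i, g ∘ c i = h ∘ c i) -> g = h) ->
  (forall i, d ∘ c i = tmapl T C (c i) ∘ coact (F i)) ->
  is_coaction d.
Proof.
move=> ce dE; split; apply: ce => i; rewrite -compmA dE compmA.
  by rewrite counit_natural -compmA coact_counit compm1 comp1m.
rewrite comul_natural -compmA coact_comul compmA -tmapl_comp -dE tmapl_comp.
by rewrite -!compmA dE.
Qed.

(** Dually, the axioms of [P] restrict along [i]; coassociativity is compared in (P ⊗ C) ⊗ C, hence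
    the second mono. *)
Lemma monic_coaction (X : S) (P : SC) (i : hom S X (P : comod))
    (d : hom S X (tobj T X C)) :
  is_mono i -> is_mono (tmapl T C (tmapl T C i)) ->
  coact P ∘ i = tmapl T C i ∘ d -> is_coaction d.
Proof.
move=> mi mti dE; split.
  by apply: mi; rewrite compmA -counit_natural -compmA -dE compmA coact_counit
    comp1m compm1.
apply: mti; rewrite compmA -comul_natural -compmA -dE compmA coact_comul.
by rewrite -compmA dE compmA -tmapl_comp dE tmapl_comp -compmA.
Qed.

Definition underlying_diagram (J : small_category) (F : diagram SC J) :
  diagram S J.
Proof.
unshelve refine (@Diagram k S J (fun j => (F j : comod))
  (fun i j u => cval (dmap F u)) _ _).
- by move=> i; rewrite dmap_id.
- by move=> i j l v u; rewrite dmap_comp.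
Defined.

Lemma comodule_colimit (J : small_category) (F : diagram SC J) :
  cocomplete S ->
  exists (P : SC) (c : forall j, hom SC (F j) P),
    is_colimit c /\ @is_colimit _ _ _ (underlying_diagram F) _ (fun j => cval (c j)).
Proof.
move=> ccS; have [X [c cX]] := ccS J (underlying_diagram F).
have ce Y (g h : hom S X Y) : (forall j, g ∘ c j = h ∘ c j) -> g = h.
  exact: (colimit_eq cX).
(* The coaction on [X] is induced by the coactions of the [F j] followed by c j ⊗ C. *)
have [|d dE] := @colimit_desc _ _ _ _ _ _ c
    (fun j => tmapl T C (c j) ∘ coact (F j)) cX.
  move=> i j u; rewrite /= -compmA coact_cval compmA -tmapl_comp.
  by have := proj1 cX _ _ u => /= ->.
pose P := coaction_comodule (epic_coaction ce dE).
have /dep_choice[c' c'E] j : exists g : hom SC (F j) P, cval g = c j.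
  exact/cval_exists/dE.
have cE : c = (fun j => cval (c' j)).
  by apply: functional_extensionality_dep => j; rewrite c'E.
exists P, c'; split; last by rewrite -cE.
apply: is_colimitI.
- by move=> i j u; apply: cval_inj; rewrite cval_comp !c'E; exact: (proj1 cX).
- move=> Y g h gh; apply/cval_inj/ce => j.
  by rewrite -c'E; exact: (congr1 (@cval _ _) (gh j)).
- move=> Y e ce'.
  have [|h hE] := @colimit_desc _ _ _ _ _ _ c (fun j => cval (e j)) cX.
    by move=> i j u; rewrite /= -cval_comp ce'.
  have [|h' h'E] := @cval_exists P Y h.
    apply: (ce) => j; rewrite -!compmA hE coact_cval -hE tmapl_comp -compmA.
    by congr (_ ∘ _); rewrite /= dE.
  by exists h' => j; apply: cval_inj; rewrite cval_comp h'E c'E hE.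
Qed.

(** [P] is a retract, compatibly with the cocones, of the colimit built by [comodule_colimit]; this
    suffices to transport the universal property in [S]. *)
Lemma underlying_colimit (J : small_category) (F : diagram SC J) (P : SC)
    (c : forall j, hom SC (F j) P) :
  cocomplete S -> is_colimit c ->
  @is_colimit _ _ _ (underlying_diagram F) _ (fun j => cval (c j)).
Proof.
move=> ccS cP; have [Q [d [dQ uQ]]] := comodule_colimit F ccS.
have [s sE] := colimit_desc dQ (proj1 cP).
have [t tE] := colimit_desc cP (proj1 dQ).
have st : s ∘ t = idm SC P.
  by apply: (colimit_eq cP) => j; rewrite -compmA tE sE comp1m.
apply: is_colimitI.
- by move=> i j u; rewrite /= -cval_comp (proj1 cP).
- move=> Y g h gh; rewrite -[g]compm1 -[h]compm1 -cval_id -st cval_comp !compmA.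
  congr (_ ∘ _); apply: (colimit_eq uQ) => j.
  by rewrite -!compmA -cval_comp sE.
- move=> Y e /(colimit_desc uQ)[h hE].
  by exists (h ∘ cval t) => j; rewrite -compmA -cval_comp tE.
Qed.

(** The factorization found in [S] commutes with the coactions because this may be checked after the
    epi [cval p]. *)
Lemma reflect_cokernel (P Q R : SC) (f : hom SC P Q) (p : hom SC Q R) :
  is_cokernel (cval f) (cval p) -> is_cokernel f p.
Proof.
move=> fp; have ep := cokernel_epi fp.
apply: is_cokernelI.
- by apply: cval_inj; rewrite cval_comp (proj1 fp).
- by move=> W g h gh; apply/cval_inj/ep; rewrite -!cval_comp gh.
- move=> W g gf; have [|h hE] := cokernel_desc (g := cval g) fp.
    by rewrite -cval_comp gf.
  have [|h' h'E] := @cval_exists R W h.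
    apply: ep; rewrite -!compmA hE !coact_cval -hE tmapl_comp.
    by rewrite compmA.
  by exists h'; apply: cval_inj; rewrite cval_comp h'E.
Qed.

Lemma comodule_cokernel (P Q : SC) (f : hom SC P Q) : abelian S ->
  exists (R : SC) (p : hom SC Q R), is_cokernel (cval f) (cval p).
Proof.
move=> abS; have [X [p fp]] := abelian_cokernel abS (cval f).
have ep := cokernel_epi fp.
have [|d dE] := cokernel_desc (g := tmapl T C p ∘ coact Q) fp.
  by rewrite -compmA coact_cval compmA -tmapl_comp (proj1 fp) tmapl0 comp0m.
have ax : is_coaction d.
  apply: (@epic_coaction unit (fun=> Q) X (fun=> p)) => // Y g h gh.
  exact: ep (gh tt).
have [p' p'E] := @cval_exists Q (coaction_comodule ax) p dE.
by exists (coaction_comodule ax), p'; rewrite p'E.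
Qed.

Lemma underlying_cokernel (P Q R : SC) (f : hom SC P Q) (p : hom SC Q R) :
  abelian S -> is_cokernel f p -> is_cokernel (cval f) (cval p).
Proof.
move=> abS fp; have [R' [p' fp']] := comodule_cokernel f abS.
have cfp' := reflect_cokernel fp'.
have [s sE] := cokernel_desc fp (proj1 cfp').
have [t tE] := cokernel_desc cfp' (proj1 fp).
have ts : t ∘ s = idm SC R.
  by apply: (cokernel_epi fp); rewrite -compmA sE tE comp1m.
apply: is_cokernelI.
- by rewrite -cval_comp (proj1 fp).
- move=> W g h gh; rewrite -[g]compm1 -[h]compm1 -cval_id -ts cval_comp !compmA.
  congr (_ ∘ _); apply: (cokernel_epi fp').
  by rewrite -!compmA -cval_comp tE.
- move=> W g /(cokernel_desc fp')[h hE].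
  by exists (h ∘ cval s); rewrite -compmA -cval_comp sE.
Qed.

(** The cokernel of [f] computed in [S] is a comodule morphism killing [f], hence zero. *)
Lemma underlying_epi (P Q : SC) (f : hom SC P Q) :
  abelian S -> is_epi f -> is_epi (cval f).
Proof.
move=> abS ef; have [R [p fp]] := comodule_cokernel f abS.
have p0 : p = 0.
  by apply: ef; apply: cval_inj; rewrite cval_comp (proj1 fp) comp0m.
apply: epi0 => W g /(cokernel_desc fp)[h <-].
by rewrite p0 cval0 compm0.
Qed.

(** * Kernels of comodules, abelianness and AB5 *)

Hypothesis abS : abelian S.
Hypothesis exS : exact_filtered_colimits S.

(** The factorization found in [S] commutes with the coactions because i ⊗ C is still mono. *)
Lemma reflect_kernel (P Q R : SC) (f : hom SC P Q) (i : hom SC R P) :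
  is_kernel (cval f) (cval i) -> is_kernel f i.
Proof.
move=> fi; have mi := kernel_mono fi.
apply: is_kernelI.
- by apply: cval_inj; rewrite cval_comp (proj1 fi).
- by move=> W g h gh; apply/cval_inj/mi; rewrite -!cval_comp gh.
- move=> W g gf; have [|h hE] := kernel_lift (g := cval g) fi.
    by rewrite -cval_comp gf.
  have [|h' h'E] := @cval_exists W R h.
    apply: (tensor_mono (T := T) (V := C) abS exS mi).
    by rewrite !compmA -coact_cval -tmapl_comp -compmA hE coact_cval.
  by exists h'; apply: cval_inj; rewrite cval_comp h'E.
Qed.

Lemma subcomodule_exists (P : SC) (X : S) (i : hom S X (P : comod)) d :
  is_mono i -> coact P ∘ i = tmapl T C i ∘ d ->
  exists (ax : is_coaction d) (i' : hom SC (coaction_comodule ax) P), cval i' = i.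
Proof.
move=> mi dE; have mti := tensor_mono (T := T) (V := C) abS exS mi.
have ax := monic_coaction mi (tensor_mono (T := T) (V := C) abS exS mti) dE.
by exists ax; exact: cval_exists.
Qed.

(** The coaction restricted to the kernel is killed by f ⊗ C, so it lands in the kernel tensored
    with [C]. *)
Lemma comodule_kernel (P Q : SC) (f : hom SC P Q) :
  exists (R : SC) (i : hom SC R P), is_kernel (cval f) (cval i).
Proof.
have [X [i fi]] := abelian_kernel abS (cval f).
have mi := kernel_mono fi.
have fti := tensor_kernel C T abS exS fi.
have [|d dE] := kernel_lift (g := coact P ∘ i) fti.
  by rewrite compmA -coact_cval -compmA (proj1 fi) compm0.
have [ax [i' i'E]] := subcomodule_exists mi (esym dE).
by exists (coaction_comodule ax), i'; rewrite i'E.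
Qed.

Lemma underlying_kernel (P Q R : SC) (f : hom SC P Q) (i : hom SC R P) :
  is_kernel f i -> is_kernel (cval f) (cval i).
Proof.
move=> fi; have [R' [i' fi']] := comodule_kernel f.
have cfi' := reflect_kernel fi'.
have [s sE] := kernel_lift fi (proj1 cfi').
have [t tE] := kernel_lift cfi' (proj1 fi).
have st : s ∘ t = idm SC R.
  by apply: (kernel_mono fi); rewrite compmA sE tE compm1.
apply: is_kernelI.
- by rewrite -cval_comp (proj1 fi).
- move=> W g h gh; rewrite -[g]comp1m -[h]comp1m -cval_id -st cval_comp -!compmA.
  congr (_ ∘ _); apply: (kernel_mono fi').
  by rewrite !compmA -cval_comp tE.
- move=> W g /(kernel_lift fi')[h hE].
  by exists (cval s ∘ h); rewrite compmA -cval_comp sE.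
Qed.

Lemma underlying_mono (P Q : SC) (f : hom SC P Q) : is_mono f -> is_mono (cval f).
Proof.
move=> mf; have [R [i fi]] := comodule_kernel f.
have i0 : i = 0.
  by apply: mf; apply: cval_inj; rewrite cval_comp (proj1 fi) compm0.
apply: mono0 => W g /(kernel_lift fi)[h <-].
by rewrite i0 cval0 comp0m.
Qed.

Lemma comodule_cocomplete : cocomplete S -> cocomplete SC.
Proof.
by move=> ccS J F; have [P [c [cP _]]] := comodule_colimit F ccS; exists P, c.
Qed.

Lemma comodule_abelian : cocomplete S -> abelian SC.
Proof.
move=> ccS; have ccSC := comodule_cocomplete ccS; split.
- exact: cocomplete_zero.
- exact: cocomplete_biproduct.
- move=> P Q f; have [R [i fi]] := comodule_kernel f.
  by exists R, i; exact: reflect_kernel.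
- move=> P Q f; have [R [p fp]] := comodule_cokernel f abS.
  by exists R, p; exact: reflect_cokernel.
- move=> P Q f mf; have [R [p fp]] := comodule_cokernel f abS.
  exists R, p; apply: reflect_kernel; apply: mono_kernel_cokernel => //.
  exact: underlying_mono.
- move=> P Q f ef; have [R [i fi]] := comodule_kernel f.
  exists R, i; apply: reflect_cokernel; apply: epi_cokernel_kernel => //.
  exact: underlying_epi.
Qed.

Lemma comodule_exact : cocomplete S -> exact_filtered_colimits SC.
Proof.
move=> ccS J fJ F G H a b na nb ab X Y Z c d e cX dY eZ f g fE gE.
have [] : short_exact (cval f) (cval g).
  apply: (exS (F := underlying_diagram F) (G := underlying_diagram G)
      (H := underlying_diagram H) (a := fun j => cval (a j))
      (b := fun j => cval (b j)) fJ _ _ _ (underlying_colimit ccS cX)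
      (underlying_colimit ccS dY) (underlying_colimit ccS eZ)).
  - by move=> i j u; rewrite /= -!cval_comp na.
  - by move=> i j u; rewrite /= -!cval_comp nb.
  - move=> j; case: (ab j) => kb ca; split; first exact: underlying_kernel.
    exact: underlying_cokernel.
  - by move=> j; rewrite -!cval_comp fE.
  - by move=> j; rewrite -!cval_comp gE.
by move=> kg cf; split; [exact: reflect_kernel|exact: reflect_cokernel].
Qed.

End Comodules.

(** * The generator *)

Section QuotientSet.
Variables (k : fieldType) (S : linear_category k).

(* A quotient of A is determined by the set of maps G -> A that it kills. *)
Lemma quotient_set (G A : S) : abelian S -> cocomplete S -> is_generator G ->
  exists Q : (hom S G A -> Prop) -> S, forall (L : S) (q : hom S A L), is_epi q ->
    exists (E : hom S G A -> Prop) (s : hom S (Q E) L) (t : hom S L (Q E)),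
      s ∘ t = idm S L /\ t ∘ s = idm S (Q E).
Proof.
move=> abS ccS genG.
(* [Q E] is the largest quotient of [A] killing [E]: the cokernel of the map to [A] from copies of
   [G] indexed by [E]. *)
have /dep_choice[Q QP] (E : hom S G A -> Prop) : exists (Q : S) (p : hom S A Q),
    [/\ is_epi p, forall e, E e -> p ∘ e = 0 &
      forall (Y : S) (g : hom S A Y), (forall e, E e -> g ∘ e = 0) ->
      exists h, h ∘ p = g].
  have [X [c cX]] := coproduct_exists (fun _ : {e | E e} => G) ccS.
  have [r [rE _]] := cX A sval.
  have [Q [p rp]] := abelian_cokernel abS r.
  exists Q, p; split.
  - exact: cokernel_epi rp.
  - move=> e Ee; have <- : r ∘ c (exist _ e Ee) = e := rE _.
    by rewrite compmA (proj1 rp) comp0m.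
  - move=> Y g gE; apply: (cokernel_desc rp).
    have [z [_ zU]] := cX Y (fun=> 0).
    transitivity z; [symmetry|]; apply: zU => -[e Ee]; last by rewrite comp0m.
    by rewrite -compmA rE gE.
exists Q => L q epq; pose E (e : hom S G A) := q ∘ e = 0; exists E.
have [p [ep pE pU]] := QP E.
have [s sE] := pU _ q (fun e Ee => Ee).
have [K [i qi]] := abelian_kernel abS q.
(* [p] kills the kernel of [q], since every map from [G] to that kernel gives an element of [E]. *)
have [|t tE] := cokernel_desc (g := p) (epi_cokernel_kernel abS epq qi).
  apply: genG => e; rewrite comp0m -compmA; apply: pE.
  by rewrite /E compmA (proj1 qi) comp0m.
exists s, t; split.
  by apply: epq; rewrite -compmA tE sE comp1m.
by apply: ep; rewrite -compmA sE tE comp1m.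
Qed.

Lemma coproduct_generator (I : Type) (P : I -> S) : cocomplete S ->
  (forall (X Y : S) (f g : hom S X Y),
    (forall i (h : hom S (P i) X), f ∘ h = g ∘ h) -> f = g) ->
  exists G : S, is_generator G.
Proof.
move=> ccS gen; have [G [c cG]] := coproduct_exists P ccS.
exists G => X Y f g fg; apply: gen => i h.
(* [h] is extended by zero to the other summands. *)
pose d j : hom S (P j) X := if pselect (i = j) is left e
  then ecast z (hom S (P z) X) e h else 0.
have [l [lE _]] := cG X d.
have <- : d i = h.
  by rewrite /d; case: pselect => // e; rewrite (Prop_irrelevance e erefl).
by rewrite -lE !compmA fg.
Qed.

End QuotientSet.

Section Generator.
Variables (k : fieldType) (S : linear_category k) (T : tensoring S).
Variable C : coalgebra k.
Hypotheses (abS : abelian S) (ccS : cocomplete S) (exS : exact_filtered_colimits S).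
Variable G : S.
Hypothesis genG : is_generator G.
Local Notation SC := (comodule_category T C).
Local Notation comod := (comodule T C).

(** A letter is a map k^n -> C, an endomorphism of [G] and a coordinate below n; no comodule
    enters. *)
Definition coefficient_index : Type :=
  {x : fd_category C * hom S G G & 'I_(tag x.1)}.

(* When a restriction of the coaction of h along e : G -> G takes its values in
   P (x) k^n, its n coordinates are among the coefficients of h. *)
Lemma coefficients_exist (P : SC) :
  exists coef : hom S G (P : comod) -> coefficient_index -> hom S G (P : comod),
  forall h (j : fd_category C) e t0,
    coact P ∘ h ∘ e = tmapr T (P : comod) (tagged j) ∘ t0 ->
    exists2 t, coact P ∘ h ∘ e = tmapr T (P : comod) (tagged j) ∘ t &
      forall i, tcoord T (P : comod) i ∘ t = coef h (existT _ (j, e) i).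
Proof.
have /dep_choice[t tP] (x : hom S G (P : comod) * (fd_category C * hom S G G)) :
    exists t, forall t0,
      coact P ∘ x.1 ∘ x.2.2 = tmapr T (P : comod) (tagged x.2.1) ∘ t0 ->
      coact P ∘ x.1 ∘ x.2.2 = tmapr T (P : comod) (tagged x.2.1) ∘ t.
  (* Without a factorization through P ⊗ k^n, the zero map is chosen. *)
  have [[t0 tE]|nt] := pselect (exists t0,
      coact P ∘ x.1 ∘ x.2.2 = tmapr T (P : comod) (tagged x.2.1) ∘ t0).
    by exists t0.
  by exists 0 => t0 tE; case: nt; exists t0.
exists (fun h l => tcoord T (P : comod) (tagged l) ∘ t (h, tag l)) => h j e t0 tE.
by exists (t (h, (j, e))) => //; exact: (tP (h, (j, e)) t0).
Qed.

(* The subobject generated by the iterated coefficients of h is a subcomodule;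
   A does not depend on h, since words in coefficients index its summands. *)
Lemma small_subcomodules : exists A : S,
  forall (P : SC) (h : hom S G (P : comod)),
  exists (N : SC) (m : hom SC N P) (q : hom S A (N : comod)) (x : hom S G A),
    is_epi q /\ cval m ∘ q ∘ x = h.
Proof.
have [A [c cA]] := coproduct_exists (fun _ : seq coefficient_index => G) ccS.
exists A => P h; have [coef coefP] := coefficients_exist P.
(* A word takes coefficients successively, its head last; the empty word gives [h], whence the
   witness [c [::]] at the end. *)
pose word := foldr (fun l h' => coef h' l) h.
have [a [aE _]] := cA (P : comod) word.
have [N [q [m [epq mm mq]]]] := coimage_exists a abS.
have [Q [p mp]] := abelian_cokernel abS m.
have word0 w : p ∘ word w = 0.
  by rewrite -aE -mq -!compmA compmA (proj1 mp) comp0m.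
(* N ⊗ C is the kernel of p ⊗ C, so this makes the coaction of [P] restrict to [N]. *)
have coactN : tmapl T C p ∘ (coact P ∘ m) = 0.
  apply: epq; rewrite comp0m -!compmA mq.
  have [z [_ zU]] := cA (tobj T Q C) (fun=> 0).
  transitivity z; [symmetry|]; apply: zU => w; last by rewrite comp0m.
  rewrite -!compmA aE.
(* P ⊗ C is the colimit of the P ⊗ k^n, so it suffices to treat maps [b] along which the coaction
   lifts to some P ⊗ k^n. *)
apply: (filtered_pullback_cover abS ccS exS (fd_filtered C)
    (fd_colimit C T P) (h := coact P ∘ word w) _) => j V b t bt.
  apply: genG => e; rewrite comp0m.
  have [|t' t'E t'i] := coefP (word w) j (b ∘ e) (t ∘ e).
    by rewrite !compmA bt.
  have -> : tmapl T C p ∘ (coact P ∘ word w) ∘ b ∘ e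
      = tmapl T C p ∘ (coact P ∘ word w ∘ (b ∘ e)) by rewrite !compmA.
  have pt' : tmapl T _ p ∘ t' = 0.
    rewrite -[t']comp1m tcoord_sum compm_suml compm_sumr big1 // => i _.
    (* The [i]-th coordinate of [t'] is the word [w] extended by one letter, and [p] kills all
       words. *)
    have := word0 (existT _ (j, b ∘ e) i :: w); rewrite /= -t'i => pt.
    by rewrite -compmA compmA tmapl_tunit -compmA pt compm0.
  by rewrite t'E compmA -tmaprl -compmA pt' compm0.
have ktm := tensor_kernel C T abS exS (mono_kernel_cokernel abS mm mp).
have [d dE] := kernel_lift ktm coactN.
have [ax [m' m'E]] := subcomodule_exists abS exS mm (esym dE).
exists (coaction_comodule ax), m', q, (c [::]); split=> //.
by rewrite m'E mq aE.
Qed.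

(** Every map from [G] to a comodule factors through a subcomodule isomorphic to some [U i], so the
    family [U] detects equality of morphisms. *)
Lemma comodule_generator : exists U : SC, is_generator U.
Proof.
have [A AP] := small_subcomodules.
have [Q QP] := quotient_set (G := G) A abS ccS genG.
pose I := {E : hom S G A -> Prop & {d : hom S (Q E) (tobj T (Q E) C) | is_coaction d}}.
pose U (i : I) : SC := coaction_comodule (svalP (tagged i)).
apply: (@coproduct_generator _ SC I U (comodule_cocomplete ccS)) => X Y f g fg.
apply/cval_inj/genG => h.
have [N [m [q [x [epq <-]]]]] := AP X h.
have [E [s [t [st ts]]]] := QP _ q epq.
(* The coaction of [N] transported along its isomorphism with [Q E]. *)
pose d := tmapl T C t ∘ coact N ∘ s.
have ax : is_coaction d.
  apply: (@epic_coaction _ _ _ _ unit (fun=> N) _ (fun=> t)) => [V u v uv|_].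
    by rewrite -[u]compm1 -[v]compm1 -ts !compmA (uv tt).
  by rewrite /d -compmA st compm1.
have [|s' s'E] := @cval_exists _ _ T C (U (existT _ E (exist _ d ax))) N s.
  by rewrite /= /d !compmA -tmapl_comp st tmapl_id comp1m.
have := congr1 (@cval _ _ _ _ _ _) (fg _ (m ∘ s')).
rewrite !cval_comp s'E => /(congr1 (compm^~ t)).
by rewrite -!compmA st !compm1 !compmA => ->.
Qed.

End Generator.

Theorem theorem3p3 (k : fieldType) (S : linear_category k) (T : tensoring S)
    (C : coalgebra k) :
  grothendieck S -> grothendieck (comodule_category T C).
Proof.
move=> [abS ccS exS [G genG]]; split.
- exact: comodule_abelian.
- exact: comodule_cocomplete.
- exact: comodule_exact.
- exact: comodule_generator genG.
Qed.
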